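(* There is a strongly polynomial algorithm which, given an Eulerian digraph $G$ and two chip-distributions $x,y$ on $G$, decides whether $x\leadsto y$.
   Context: A digraph is a weakly connected directed graph on a finite vertex set $V$, possibly with multiple edges but no loops, given as input by its adjacency matrix (multiplicities in binary); it is Eulerian if every vertex has equal in- and out-degree. $\overrightarrow{d}(u,v)$ is the number of edges from $u$ to $v$ and $d^+(v)$ the out-degree. The Laplacian $L$ has $L(v,v)=-d^+(v)$ and $L(u,v)=\overrightarrow{d}(v,u)$ for $u\ne v$. A chip-distribution is $x\in\mathbb{Z}_+^V$. Firing $v$ replaces $x$ by $x+L\mathbf{1}_v$; it is legal if $x(v)\ge d^+(v)$. $x\leadsto y$ means some legal sequence of firings (possibly empty) transforms $x$ into $y$. An algorithm is strongly polynomial if, counting arithmetic operations and comparisons as unit cost, the number of operations is polynomial in the number of integers in the input, and the space used is polynomial in the input size. *)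

(* Defs.v *)
From HB Require Import structures.
From mathcomp Require Import all_boot all_order all_algebra.
Set Implicit Arguments. Unset Strict Implicit. Unset Printing Implicit Defensive.
Import Order.TTheory GRing.Theory Num.Theory.
Local Open Scope ring_scope.

(** * Chip-firing on digraphs *)

(* A directed multigraph on 'I_n is given by its adjacency matrix:
   [G u v] is the number of edges from u to v. *)
Section ChipFiring.
Variable n : nat.
Implicit Types (G : 'M[nat]_n) (x y : 'cV[int]_n) (u v : 'I_n).

Definition loopless G : Prop := forall v, G v v = 0%N.

Definition weakly_connected G : Prop :=
  forall u v, connect [rel a b | (0 < G a b)%N || (0 < G b a)%N] u v.

Definition digraph G : Prop := loopless G /\ weakly_connected G.

Definition outdeg G v : nat := (\sum_(u < n) G v u)%N.
Definition indeg G v : nat := (\sum_(u < n) G u v)%N.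

Definition eulerian G : Prop := forall v, indeg G v = outdeg G v.

Definition laplacian G : 'M[int]_n :=
  \matrix_(u, v) (if u == v then - (outdeg G v)%:Z else (G v u)%:Z).

Definition chip_distribution x : Prop := forall v, 0 <= x v 0.

Definition fire G x v : 'cV[int]_n := x + laplacian G *m delta_mx v 0.

Definition legal_firing G x v : bool := (outdeg G v)%:Z <= x v 0.

Fixpoint legal_game G x (s : seq 'I_n) : bool :=
  if s is v :: s' then legal_firing G x v && legal_game G (fire G x v) s'
  else true.

Definition reachable G x y : Prop :=
  exists s : seq 'I_n, legal_game G x s /\ foldl (fire G) x s = y.

End ChipFiring.

(** * Random access programs over the integers *)

(* The memory consists of finitely many arrays of integers.  Arrays grow on
   demand: a cell that has never been written contains 0, and writing beyond
   the end of an array first pads it with zeros, which count as used space.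
   The address denoted by an integer is its absolute value. *)
Definition store := seq (seq int).

Definition get (s : store) (a : nat) (i : int) : int :=
  nth 0 (nth [::] s a) `|i|%N.

Definition upd (s : store) (a : nat) (i z : int) : store :=
  set_nth [::] s a (set_nth 0 (nth [::] s a) `|i|%N z).

Inductive binop := OAdd | OSub | OMul | OQuo | ORem | OLeq | OEq.

(* [OQuo] and [ORem] are integer division with remainder; comparisons return 0
   or 1. *)
Definition eval_binop (o : binop) (x y : int) : int :=
  match o with
  | OAdd => x + y
  | OSub => x - y
  | OMul => x * y
  | OQuo => (x %/ y)%Z
  | ORem => (x %% y)%Z
  | OLeq => if x <= y then 1 else 0
  | OEq => if x == y then 1 else 0
  end.

Inductive expr :=
  | Const of int
  | Get of nat & expr             (* array name, index *)
  | Bin of binop & expr & expr.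

Fixpoint eval (s : store) (e : expr) : int :=
  match e with
  | Const z => z
  | Get a i => get s a (eval s i)
  | Bin o e1 e2 => eval_binop o (eval s e1) (eval s e2)
  end.

Inductive cmd :=
  | Skip
  | Assign of nat & expr & expr   (* array name, index, new value *)
  | Seq of cmd & cmd
  | If of expr & cmd & cmd        (* any nonzero value counts as true *)
  | While of expr & cmd.

(* Binary length of an integer, with one extra bit for the sign. *)
Definition bitlen (z : int) : nat := (up_log 2 `|z|.+1).+1.

Definition num_ints (s : store) : nat := (\sum_(a <- s) size a)%N.
Definition bit_size (s : store) : nat := (\sum_(a <- s) \sum_(z <- a) bitlen z)%N.

(* Unit cost for each constant, memory access, arithmetic operation and
   comparison. *)
Fixpoint expr_cost (e : expr) : nat :=
  match e with
  | Const _ => 1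
  | Get _ i => (expr_cost i).+1
  | Bin _ e1 e2 => (expr_cost e1 + expr_cost e2).+1
  end.

(* Space taken by all the intermediate results of an evaluation. *)
Fixpoint expr_space (s : store) (e : expr) : nat :=
  (bitlen (eval s e) +
   match e with
   | Const _ => 0
   | Get _ i => expr_space s i
   | Bin _ e1 e2 => expr_space s e1 + expr_space s e2
   end)%N.

(* [exec p s t m s']: started in the store s, the program p halts in the store
   s' after t unit-cost operations; m is the peak number of bits in use. *)
Inductive exec : cmd -> store -> nat -> nat -> store -> Prop :=
  | ExecSkip s :
      exec Skip s 1 (bit_size s) s
  | ExecAssign s a i e (s' := upd s a (eval s i) (eval s e)) :
      exec (Assign a i e) s (expr_cost i + expr_cost e).+1
        (maxn (bit_size s + expr_space s i + expr_space s e) (bit_size s')) s'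
  | ExecSeq p q s t1 m1 s1 t2 m2 s2 :
      exec p s t1 m1 s1 -> exec q s1 t2 m2 s2 ->
      exec (Seq p q) s (t1 + t2) (maxn m1 m2) s2
  | ExecIf e p q s t m s' :
      exec (if eval s e != 0 then p else q) s t m s' ->
      exec (If e p q) s (expr_cost e + t).+1
        (maxn (bit_size s + expr_space s e) m) s'
  | ExecWhileFalse e p s :
      eval s e = 0 ->
      exec (While e p) s (expr_cost e).+1 (bit_size s + expr_space s e) s
  | ExecWhileTrue e p s t1 m1 s1 t2 m2 s2 :
      eval s e != 0 -> exec p s t1 m1 s1 -> exec (While e p) s1 t2 m2 s2 ->
      exec (While e p) s (expr_cost e + t1 + t2).+1
        (maxn (bit_size s + expr_space s e) (maxn m1 m2)) s2.

(* Hence the run whose existence is asserted in [strongly_polynomial_decider]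
   is the only one. *)
Lemma exec_det p s t1 m1 s1 : exec p s t1 m1 s1 ->
  forall t2 m2 s2, exec p s t2 m2 s2 -> [/\ t1 = t2, m1 = m2 & s1 = s2].
Proof.
elim=> {p s t1 m1 s1} [s|s a i e s'|p q s t1 m1 s1 t2 m2 s2 _ IH1 _ IH2
  |e p q s t m s' _ IH|e p s e0|e p s t1 m1 s1 t2 m2 s2 e1 _ IH1 _ IH2] t3 m3 s3 E;
  inversion E; subst=> //.
- by case: (IH1 _ _ _ ltac:(eassumption)) => ? ? ?; subst;
    case: (IH2 _ _ _ ltac:(eassumption)) => -> -> ->.
- by case: (IH _ _ _ ltac:(eassumption)) => -> -> ->.
- by move: e0 => /eqP e0; match goal with H : is_true (_ != 0) |- _ => rewrite e0 in H end.
- by match goal with H : eval _ _ = 0 |- _ => rewrite H eqxx in e1 end.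
- by case: (IH1 _ _ _ ltac:(eassumption)) => ? ? ?; subst;
    case: (IH2 _ _ _ ltac:(eassumption)) => -> -> ->.
Qed.

(* The instances i : I of the problem are presented to p as the initial store
   [enc i]; the answer, 1 if Q i holds and 0 otherwise, is left in cell 0 of
   array 0.  The number of operations is polynomial in the number of input
   integers, the space is polynomial in the bit size of the input. *)
Definition strongly_polynomial_decider (p : cmd) (I : Type)
    (enc : I -> store) (Q : I -> Prop) : Prop :=
  exists c k : nat, forall i : I, exists t m s',
    [/\ exec p (enc i) t m s',
        (t <= c * num_ints (enc i) ^ k + c)%N,
        (m <= c * bit_size (enc i) ^ k + c)%N &
        (get s' 0 0 = 1 /\ Q i) \/ (get s' 0 0 = 0 /\ ~ Q i)].

(** * The reachability problem on Eulerian digraphs *)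

Record reach_instance := ReachInstance {
  nvert : nat;
  graph : 'M[nat]_nvert;
  source : 'cV[int]_nvert;
  target : 'cV[int]_nvert;
  graph_digraph : digraph graph;
  graph_eulerian : eulerian graph;
  source_chips : chip_distribution source;
  target_chips : chip_distribution target }.

(* Arrays 0 to 3: the number of vertices, the adjacency matrix in row-major
   order, and the two chip-distributions. *)
Definition encode (i : reach_instance) : store :=
  [:: [:: (nvert i)%:Z];
      [seq (graph i u v)%:Z | u <- enum 'I_(nvert i), v <- enum 'I_(nvert i)];
      [seq source i v 0 | v <- enum 'I_(nvert i)];
      [seq target i v 0 | v <- enum 'I_(nvert i)]].

(* Main.v *)
Require Import Defs.
From mathcomp Require Import all_boot all_order all_algebra perm zify ring.
Set Implicit Arguments. Unset Strict Implicit. Unset Printing Implicit Defensive.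
Import Order.TTheory GRing.Theory Num.Theory.
Local Open Scope ring_scope.

(* Let L be the Laplacian and J the all-ones matrix. Since L has kernel the
   constant vectors, there is at most one integral f with y = x + L f and
   min f = 0. Then x ~> y if and only if f exists and no nonempty set W of
   vertices in the support of f is stuck, i.e. satisfies
   y(v) < d(W, v) for all v in W. Indeed, among the vertices of W let v be the
   one whose last firing comes first: from then on v receives at least d(W, v)
   chips. Conversely, if no W is stuck, the whole support can be fired once,
   vertex by vertex, ending in y; the distribution before that dominates y on
   the support, so one can induct on f.

   The vector f is computed from the adjugate of L - J, which is invertible
   because L is negative semidefinite with constant kernel. The adjugate comes
   from the Faddeev-LeVerrier recursion, whose divisions are exact and whose
   intermediate values grow by a polynomial factor per step. The condition on
   the sets W is decided by burning: repeatedly remove from the support a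
   vertex v with y(v) >= d(support, v). *)

(** * Reachability and stuck sets *)

Lemma sum_Posz (I : finType) (P : pred I) (F : I -> nat) :
  (\sum_(i | P i) F i)%N%:Z = \sum_(i | P i) (F i)%:Z.
Proof. by rewrite -natz natr_sum; apply: eq_bigr => i _; rewrite natz. Qed.

Section Criterion.
Variable n : nat.
Implicit Types (G : 'M[nat]_n) (x y f : 'cV[int]_n) (u v : 'I_n) (W : {set 'I_n}).

Definition inflow G W v : nat := (\sum_(u in W) G u v)%N.

Definition stuck G y W : Prop := forall v, v \in W -> y v 0 < (inflow G W v)%:Z.

Lemma laplacian_mulE G f v : loopless G ->
  (laplacian G *m f) v 0 = \sum_u (G u v)%:Z * f u 0 - (outdeg G v)%:Z * f v 0.
Proof.
move=> lG; rewrite mxE (bigD1 v) //= mxE eqxx [in RHS](bigD1 v) //= lG mul0r add0r addrC mulNr.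
by congr (_ - _); apply: eq_bigr => u uv; rewrite mxE eq_sym (negPf uv).
Qed.

Lemma fireE G x v w : loopless G ->
  fire G x v w 0 = x w 0 + (G v w)%:Z - (outdeg G w)%:Z *+ (w == v).
Proof.
move=> lG; rewrite /fire mxE laplacian_mulE // !mxE eqxx andbT mulrb addrA.
congr (_ + _ - _); last by case: (w == v); rewrite ?mulr1 ?mulr0.
rewrite (bigD1 v) //= mxE !eqxx mulr1 big1 ?addr0 // => u uv.
by rewrite mxE (negPf uv) mulr0.
Qed.

(** Firing is additive, so the outcome of a game depends only on how often each vertex fires. *)
Lemma foldl_fireE G x s :
  foldl (fire G) x s = x + laplacian G *m \col_v (count_mem v s)%:Z.
Proof.
elim: s x => [|a s IH] x /=.
  suff -> : \col_(v < n) (Posz 0) = 0 :> 'cV[int]_n by rewrite mulmx0 addr0.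
  by apply/colP => v; rewrite !mxE.
rewrite IH /fire -addrA -mulmxDr; congr (_ + _ *m _).
apply/colP => v; rewrite !mxE eqxx andbT PoszD.
by rewrite (eq_sym a v); case: (v == a).
Qed.

(** Applied to the part of a game that follows the last firing of [v]. *)
Lemma foldl_fire_ge G x s v : loopless G -> v \notin s ->
  x v 0 + (\sum_u count_mem u s * G u v)%N%:Z <= foldl (fire G) x s v 0.
Proof.
move=> lG vs; rewrite foldl_fireE mxE laplacian_mulE // lerD2l !mxE (count_memPn vs) mulr0 subr0.
by rewrite sum_Posz; apply: ler_sum => u _; rewrite mxE PoszM mulrC.
Qed.

Lemma chip_fire G x v : loopless G -> chip_distribution x -> legal_firing G x v ->
  chip_distribution (fire G x v).
Proof.
move=> lG cx; rewrite /legal_firing => lv w; rewrite fireE //; have := cx w.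
by case: eqP => [->|_] /=; rewrite ?mulr1n ?mulr0n; lia.
Qed.

(* The vertex of W whose last firing comes first receives at least one batch
   of chips from every other vertex of W after that firing. *)
Lemma legal_game_not_stuck G x s W : loopless G -> chip_distribution x ->
  legal_game G x s -> W != set0 -> {subset W <= s} ->
  ~ stuck G (foldl (fire G) x s) W.
Proof.
move=> lG; elim: s x => [|a s IH] x cx /=.
  by move=> _ /set0Pn [w wW] /(_ _ wW).
case/andP=> la ls W0 Ws; have cx' := chip_fire lG cx la.
(* A vertex [w] of [W] missing from [s] must be [a], fired here for the last time; all other
   vertices of [W] still fire in [s]. *)
have [Ws'|] := boolP [forall w, (w \in W) ==> (w \in s)].
  by apply: IH => // w wW; apply: (implyP (forallP Ws' w)).
rewrite negb_forall => /existsP [w]; rewrite negb_imply => /andP [wW ws].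
have aw : w = a by move: (Ws _ wW); rewrite inE (negPf ws) orbF => /eqP.
move=> /(_ _ wW); apply/negP; rewrite -leNgt.
apply: le_trans (foldl_fire_ge _ lG ws).
suff : (inflow G W w <= \sum_u count_mem u s * G u w)%N by have := cx' w; lia.
rewrite /inflow big_mkcond; apply: leq_sum => u _; case: ifP => // uW.
have [->|uw] := eqVneq u w; first by rewrite lG.
have : u \in s by have := Ws _ uW; rewrite inE -aw (negPf uw).
by rewrite -has_pred1 has_count; case: (count _ _) => // k _; rewrite mulSn leq_addr.
Qed.

Lemma reachable_refl G x : reachable G x x.
Proof. by exists [::]. Qed.

Lemma legal_game_cat G x s1 s2 : legal_game G x (s1 ++ s2) =
  legal_game G x s1 && legal_game G (foldl (fire G) x s1) s2.
Proof. by elim: s1 x => //= a s1 IH x; rewrite IH andbA. Qed.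

Lemma reachable_trans G x y z : reachable G x y -> reachable G y z -> reachable G x z.
Proof.
case=> s1 [l1 e1] [s2 [l2 e2]]; exists (s1 ++ s2).
by rewrite legal_game_cat foldl_cat l1 e1.
Qed.

Definition ind W : 'cV[int]_n := \col_v (v \in W)%:Z.

Lemma laplacian_ind G W v : loopless G ->
  (laplacian G *m ind W) v 0 = (inflow G W v)%:Z - (outdeg G v)%:Z *+ (v \in W).
Proof.
move=> lG; rewrite laplacian_mulE // mxE; congr (_ - _); last first.
  by case: (v \in W); rewrite ?mulr1 ?mulr0.
rewrite /inflow sum_Posz [RHS]big_mkcond; apply: eq_bigr => u _.
by rewrite mxE; case: (u \in W); rewrite ?mulr1 ?mulr0.
Qed.

(** By induction on [W]: since [W] is not stuck, some [v] in [W] has y(v) >= d(W, v). It can fire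
    first, as it holds y(v) - d(W, v) + d+(v) chips at the start, and [W :\ v] remains. *)
Lemma fire_set G y W : loopless G ->
  (forall W', W' \subset W -> W' != set0 -> ~ stuck G y W') ->
  reachable G (y - laplacian G *m ind W) y.
Proof.
move=> lG; have [k] := ubnP #|W|; elim: k W => // k IH W.
rewrite ltnS => leW nst.
have [->|W0] := eqVneq W set0.
  suff -> : ind set0 = 0 by rewrite mulmx0 subr0; apply: reachable_refl.
  by apply/colP => v; rewrite !mxE inE.
have [v vW yv] : exists2 v, v \in W & (inflow G W v)%:Z <= y v 0.
  have [/existsP [v /andP [? ?]]|] :=
    boolP [exists v, (v \in W) && ((inflow G W v)%:Z <= y v 0)]; first by exists v.
  rewrite negb_exists => /forallP H; case: (nst W) => // v vW.
  by have := H v; rewrite vW /= -ltNge.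
have eW : ind W = ind (W :\ v) + delta_mx v 0.
  apply/colP => w; rewrite !mxE !inE eqxx andbT.
  by have [->|] := eqVneq w v; rewrite ?vW ?addr0.
apply: (@reachable_trans _ _ (y - laplacian G *m ind (W :\ v))); last first.
  apply: IH => [|W' sW']; first by rewrite (cardsD1 v) vW in leW.
  by apply: nst; apply: subset_trans sW' (subsetDl _ _).
exists [:: v]; rewrite /= andbT; split; last first.
  by rewrite /fire eW mulmxDr opprD addrA subrK.
by rewrite /legal_firing mxE [X in _ + X]mxE laplacian_ind // vW mulr1n opprB addrCA lerDl subr_ge0.
Qed.

(** Induction on the sum of [f]: the support fires once at the end, and what precedes is the same
    problem for [f] minus the indicator of its support. *)
Lemma reachable_of_not_stuck G x y f : loopless G -> eulerian G ->
  (forall v, 0 <= f v 0) -> y = x + laplacian G *m f ->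
  (forall W, {in W, forall v, f v 0 != 0} -> W != set0 -> ~ stuck G y W) ->
  reachable G x y.
Proof.
move=> lG eG f0 -> nst.
have [k] := ubnP (\sum_v absz (f v 0%R))%N; elim: k f f0 nst => // k IH f f0 nst lek.
pose S := [set v | f v 0 != 0].
have [S0|/set0Pn [w wS]] := eqVneq S set0.
  suff -> : f = 0 by rewrite mulmx0 addr0; apply: reachable_refl.
  apply/colP => v; rewrite mxE; apply/eqP; have := in_set0 v.
  by rewrite -S0 inE => /negbFE.
have nS W' : W' \subset S -> W' != set0 -> ~ stuck G (x + laplacian G *m f) W'.
  by move=> /subsetP sW'; apply: nst => v /sW'; rewrite inE.
apply: (reachable_trans _ (fire_set lG nS)).
rewrite -addrA -mulmxBr; apply: IH => [v|W fW W0 st|].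
- by rewrite !mxE inE; have := f0 v; case: eqP => /= [->|]; lia.
- have WS : W \subset S.
    by apply/subsetP => v /fW; rewrite !mxE !inE; case: (eqVneq (f v 0) 0) => //= ->.
  (* A set stuck before [S] fires is stuck afterwards too: on [S] the earlier distribution exceeds
     the later one by d+(v) - d(S, v), which is nonnegative because d+(v) is also the in-degree. *)
  apply: (nS W) => // v vW; apply: le_lt_trans (st v vW).
  rewrite mulmxBr addrA [in leRHS]mxE lerDl mxE laplacian_ind // (subsetP WS) // mulr1n.
  rewrite -eG /indeg opprB subr_ge0 lez_nat /inflow.
  by rewrite [leqRHS](bigID [in S]) /= leq_addr.
- rewrite -ltnS; apply: leq_trans lek; rewrite ltnS.
  rewrite (bigD1 w) //= [ltnRHS](bigD1 w) //= -addSn leq_add //.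
    by move: wS (f0 w); rewrite !mxE !inE => w0; rewrite w0 /=; lia.
  by apply: leq_sum => v _; rewrite !mxE inE; have := f0 v; case: eqP => /= [->|]; lia.
Qed.

(** * The Laplacian as a quadratic form, and its kernel *)

(** The Dirichlet energy. When the square is expanded, both square terms sum to [D], one through
    out-degrees and the other through in-degrees, which agree. *)
Lemma laplacian_quad G f : loopless G -> eulerian G ->
  \sum_u \sum_v (G u v)%:Z * (f u 0 - f v 0) ^+ 2 =
  - (\sum_v f v 0 * (laplacian G *m f) v 0) *+ 2.
Proof.
move=> lG eG.
pose D := \sum_v (outdeg G v)%:Z * f v 0 ^+ 2.
pose C := \sum_u \sum_v (G u v)%:Z * f u 0 * f v 0.
have -> : \sum_v f v 0 * (laplacian G *m f) v 0 = C - D.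
  rewrite /C exchange_big -sumrB; apply: eq_bigr => v _.
  rewrite laplacian_mulE // mulrBr mulr_sumr; congr (_ - _); last by ring.
  by apply: eq_bigr => u _; ring.
have D1 : D = \sum_u \sum_v (G u v)%:Z * f u 0 ^+ 2.
  by apply: eq_bigr => u _; rewrite -mulr_suml /outdeg sum_Posz.
have D2 : D = \sum_u \sum_v (G u v)%:Z * f v 0 ^+ 2.
  by rewrite exchange_big; apply: eq_bigr => u _; rewrite -mulr_suml -eG /indeg sum_Posz.
transitivity (D + D - C *+ 2); last by ring.
rewrite {1}D1 D2 /C -sumrMnl -big_split -sumrB; apply: eq_bigr => u _ /=.
rewrite -sumrMnl -big_split -sumrB; apply: eq_bigr => v _ /=; ring.
Qed.

(** Every edge term of [laplacian_quad] vanishes, so [f] agrees at the ends of each edge; weak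
    connectivity spreads this to all vertices. *)
Lemma harmonic_const G f : digraph G -> eulerian G ->
  \sum_v f v 0 * (laplacian G *m f) v 0 = 0 -> forall u v, f u 0 = f v 0.
Proof.
move=> [lG wG] eG q0; have := laplacian_quad f lG eG; rewrite q0 oppr0 mul0rn => /eqP.
have ge0 u v : 0 <= (G u v)%:Z * (f u 0 - f v 0) ^+ 2 by rewrite mulr_ge0 ?sqr_ge0.
rewrite psumr_eq0 => [/allP H|u _]; last by apply: sumr_ge0.
have edge u v : (0 < G u v)%N -> f u 0 = f v 0.
  move=> Guv; have := H u (mem_index_enum u); rewrite psumr_eq0 // => /allP /(_ v (mem_index_enum v)).
  by rewrite mulf_eq0 sqrf_eq0 subr_eq0 => /orP [|/eqP //]; lia.
move=> u v; have /connectP [p] := wG u v.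
elim: p u => [|w p IH] u /=; first by move=> _ ->.
by case/andP=> /orP [] /edge e pw /(IH _ pw) <-.
Qed.

Lemma laplacian_col_sum G f : loopless G -> \sum_v (laplacian G *m f) v 0 = 0.
Proof.
move=> lG; under eq_bigr do rewrite laplacian_mulE //.
rewrite sumrB exchange_big -sumrB big1 // => u _.
by rewrite -mulr_suml /outdeg sum_Posz subrr.
Qed.

Lemma laplacian_const G a : loopless G -> eulerian G -> laplacian G *m (const_mx a : 'cV_n) = 0.
Proof.
move=> lG eG; apply/colP => v; rewrite laplacian_mulE // !mxE.
by under eq_bigr do rewrite mxE; rewrite -mulr_suml -eG /indeg sum_Posz subrr.
Qed.

Lemma laplacian_inj G f g : digraph G -> eulerian G ->
  laplacian G *m f = laplacian G *m g -> forall u v, f u 0 - g u 0 = f v 0 - g v 0.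
Proof.
move=> dG eG e u v; have := @harmonic_const G (f - g) dG eG.
rewrite mulmxBr e subrr big1 => [/(_ erefl u v)|i _]; last first.
  by rewrite [X in _ * X]mxE mulr0.
by rewrite !mxE.
Qed.

Lemma reachable_iff G x y f r : digraph G -> eulerian G -> chip_distribution x ->
  (forall v, 0 <= f v 0) -> f r 0 = 0 -> y = x + laplacian G *m f ->
  reachable G x y <->
  (forall W, {in W, forall v, f v 0 != 0} -> W != set0 -> ~ stuck G y W).
Proof.
move=> dG eG cx f0 fr e; have [lG _] := dG.
split; last exact: reachable_of_not_stuck.
case=> s [ls es] W fW W0; rewrite -es; apply: legal_game_not_stuck => // v vW.
(* The firing counts differ from [f] by a constant, namely the count at [r], which is nonnegative;
   hence every vertex in the support of [f] fires in [s]. *)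
move: es; rewrite foldl_fireE e => /addrI /(laplacian_inj dG eG) /(_ v r).
rewrite !mxE fr subr0 => /eqP; rewrite subr_eq => /eqP e'.
have {}e' : (count_mem v s)%:Z = (count_mem r s)%:Z + f v 0 := e'.
by rewrite -has_pred1 has_count; have := fW v vW; have := f0 v; lia.
Qed.

End Criterion.

(** * The Faddeev-LeVerrier recursion *)

Lemma deriv_prod (R : comNzRingType) (I : finType) (F : I -> {poly R}) :
  (\prod_i F i)^`() = \sum_i (F i)^`() * \prod_(j | j != i) F j.
Proof.
suff H (r : seq I) : uniq r ->
    (\prod_(i <- r) F i)^`() = \sum_(i <- r) (F i)^`() * \prod_(j <- r | j != i) F j.
  by apply: H; apply: index_enum_uniq.
elim: r => [|a r IH]; first by rewrite !big_nil derivE.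
case/andP=> ar ur; rewrite !big_cons derivM IH // eqxx /=; congr (_ * _ + _).
  by rewrite big_seq [RHS]big_seq_cond; apply: eq_bigl => j; case: (eqVneq j a) ar => [->|]; [move/negPf=> -> | rewrite andbT].
rewrite mulr_sumr !big_seq; apply: eq_bigr => i ir; rewrite big_cons.
have -> : a != i by apply: contraNneq ar => ->.
  by rewrite mulrCA.
Qed.

(** Jacobi's formula. Differentiating row [i] in the Leibniz expansion leaves a unit row, hence the
    [i]-th diagonal cofactor. *)
Lemma deriv_char_poly (R : comNzRingType) n (A : 'M[R]_n) :
  (char_poly A)^`() = \tr (\adj (char_poly_mx A)).
Proof.
set M := char_poly_mx A.
have dM i j : (M i j)^`() = (i == j)%:R.
  by rewrite !mxE derivB derivC subr0; case: eqP; rewrite ?mulr1n ?derivX // mulr0n derivC.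
pose Mi i := \matrix_(k, j) (if k == i then (i == j)%:R else M k j).
transitivity (\sum_i \det (Mi i)).
  rewrite /char_poly -/M /determinant linear_sum /= exchange_big; apply: eq_bigr => s _ /=.
  have e i : \prod_j Mi i j (s j) = (M i (s i))^`() * \prod_(j | j != i) M j (s j).
    rewrite (bigD1 i) //= mxE eqxx dM; congr (_ * _).
    by apply: eq_bigr => j ji; rewrite mxE (negPf ji).
  under [RHS]eq_bigr do rewrite e.
  rewrite -mulr_sumr -deriv_prod.
  by case: (odd_perm s); rewrite ?expr0 ?expr1 ?mul1r ?mulN1r ?derivN.
apply: eq_bigr => i _; rewrite mxE (expand_det_row _ i) (bigD1 i) //= big1 => [|j ji].
  rewrite addr0 mxE !eqxx mul1r /cofactor; congr (_ * \det _).
  by apply/matrixP => k l; rewrite !mxE eq_sym (negPf (neq_lift _ _)).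
by rewrite mxE eqxx eq_sym (negPf ji) mul0r.
Qed.

Section FaddeevLeVerrier.
Variables (R : comNzRingType) (n : nat) (A : 'M[R]_n).

Definition adj_coef k : 'M[R]_n := map_mx (coefp k) (\adj (char_poly_mx A)).

Lemma char_poly_mx_adjE i j :
  'X * (\adj (char_poly_mx A)) i j - \sum_l (A i l)%:P * (\adj (char_poly_mx A)) l j
  = char_poly A *+ (i == j).
Proof.
have := congr1 (fun M : 'M[{poly R}]_n => M i j) (mul_mx_adj (char_poly_mx A)).
rewrite -/(char_poly A) {1}/char_poly_mx mulmxBl mul_scalar_mx.
move: (\adj _) => B; rewrite !mxE => <-; congr (_ - _).
by apply: eq_bigr => l _; rewrite mxE.
Qed.

(** The coefficient of X^(k+1) in (X I - A) adj(X I - A) = chi I, where chi is the characteristic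
    polynomial. *)
Lemma adj_coefS k :
  adj_coef k = A *m adj_coef k.+1 + ((char_poly A)`_k.+1)%:M.
Proof.
apply/matrixP => i j; have := congr1 (fun p : {poly R} => p`_k.+1) (char_poly_mx_adjE i j).
rewrite coefMn coefB coefXM coef_sum /= => e.
rewrite mxE [RHS]mxE [X in _ = _ + X]mxE -{}e !mxE /= addrC -addrA -sumrN -big_split big1 ?addr0 // => l _.
by rewrite /= coefCM [adj_coef _ _ _]mxE addNr.
Qed.

(** The constant coefficient of the same identity: [adj_coef 0] inverts [A] up to a scalar. *)
Lemma adj_coef0 : A *m adj_coef 0 + ((char_poly A)`_0)%:M = 0.
Proof.
apply/matrixP => i j; have := congr1 (fun p : {poly R} => p`_0) (char_poly_mx_adjE i j).
rewrite coefMn coefB coefXM coef_sum /= => e.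
rewrite mxE [X in _ + X = _]mxE -{}e !mxE sub0r -sumrN -big_split big1 // => l _.
by rewrite /= coefCM [adj_coef _ _ _]mxE subrr.
Qed.

(** Polynomial entries make the coefficients vanish from some [d] on; the recursion carries this
    down to [n], because the characteristic polynomial has degree [n]. *)
Lemma adj_coef_ge k : (n <= k)%N -> adj_coef k = 0.
Proof.
have [d hd] : exists d, forall k, (d <= k)%N -> adj_coef k = 0.
  exists (\max_i \max_j size (\adj (char_poly_mx A) i j)) => l hl.
  apply/matrixP => i j; rewrite mxE [in RHS]mxE /=; apply: nth_default; apply: leq_trans hl.
  apply: leq_trans (leq_bigmax (F := fun i => (\max_j size (\adj (char_poly_mx A) i j))%N) i).
  exact: (leq_bigmax (F := fun j => size (\adj (char_poly_mx A) i j)) j).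
have : (d <= k + d)%N by apply: leq_addl.
elim: {2}d k => [|e IH] k; first by rewrite addn0 => /hd.
move=> dk nk; rewrite adj_coefS IH ?addSnnS //; last exact: leqW.
rewrite mulmx0 add0r nth_default ?size_char_poly //.
by apply/matrixP => i j; rewrite !mxE mul0rn.
Qed.

Lemma trace_adj_coef k : \tr (adj_coef k) = (char_poly A)`_k.+1 *+ k.+1.
Proof.
rewrite -coef_deriv deriv_char_poly /mxtrace coef_sum.
by apply: eq_bigr => i _; rewrite mxE.
Qed.

(** Provides coefficient [k] by an exact division by n - k. Take traces in [adj_coefS] and compare
    with [trace_adj_coef]. *)
Lemma trace_mul_adj_coef k : (k <= n)%N ->
  \tr (A *m adj_coef k) = - (char_poly A)`_k *+ (n - k).
Proof.
case: k => [_|k kn].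
  by have /eqP := adj_coef0; rewrite addr_eq0 subn0 => /eqP ->; rewrite linearN /= mxtrace_scalar mulNrn.
have := trace_adj_coef k; rewrite adj_coefS linearD /= mxtrace_scalar => e.
apply: (addIr ((char_poly A)`_k.+1 *+ n)); rewrite {}e mulNrn.
by rewrite -[X in _ = _ + _ *+ X](subnK kn) mulrnDr addrA addNr add0r.
Qed.

End FaddeevLeVerrier.

(** * The firing vector *)

Section Solve.
Variables (n : nat) (G : 'M[nat]_n).
Hypotheses (dG : digraph G) (eG : eulerian G).
Implicit Types (x y f : 'cV[int]_n).

(* Subtracting the all-ones matrix makes the Laplacian invertible without
   changing its action on vectors of sum 0. *)
Definition lapJ : 'M[int]_n := laplacian G - const_mx 1.

Lemma lapJ_mulE f v : (lapJ *m f) v 0 = (laplacian G *m f) v 0 - \sum_u f u 0.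
Proof.
rewrite mulmxBl mxE; congr (_ + _); rewrite !mxE; congr (- _).
by apply: eq_bigr => u _; rewrite mxE mul1r.
Qed.

(** If (L - J) f = 0, then L f is constant, equal to the sum of f. As L f sums to 0, so does f;
    hence L f = 0 and f is constant with sum 0. *)
Lemma det_lapJ_neq0 : \det lapJ != 0.
Proof.
have [lG _] := dG; rewrite -det_tr; apply/det0P => -[w w0 /(congr1 trmx)].
rewrite trmx_mul trmxK trmx0 => /colP Lw; set f := w^T in Lw.
have fL v : (laplacian G *m f) v 0 = \sum_u f u 0.
  by apply/eqP; rewrite -subr_eq0 -lapJ_mulE Lw mxE.
have s0 : \sum_u f u 0 = 0.
  have := laplacian_col_sum f lG; under eq_bigr do rewrite fL.
  rewrite sumr_const card_ord => /eqP; rewrite mulrn_eq0 => /orP [/eqP n0|/eqP //].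
  by case/eqP: w0; apply/rowP => v; have := ltn_ord v; rewrite [X in (_ < X)%N]n0.
have fc : forall u v, f u 0 = f v 0.
  by apply: (harmonic_const dG eG); rewrite big1 // => v _; rewrite fL s0 mulr0.
case/eqP: w0; apply/rowP => v; have := s0; rewrite (eq_bigr (fun=> f v 0)) => [|u _]; last exact: fc.
rewrite sumr_const card_ord [w 0 v](_ : _ = f v 0); last by rewrite mxE.
move/eqP; rewrite mulrn_eq0 => /orP [/eqP n0|/eqP ->]; last by rewrite mxE.
by have := ltn_ord v; rewrite [X in (_ < X)%N]n0.
Qed.

Definition lapJ_coef : int := (char_poly lapJ)`_0.

Lemma lapJ_coef_neq0 : lapJ_coef != 0.
Proof. by rewrite /lapJ_coef char_poly_det mulf_neq0 ?signr_eq0 ?det_lapJ_neq0. Qed.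

Definition potential (b : 'cV[int]_n) : 'cV[int]_n := adj_coef lapJ 0 *m b.

(** Let p be the potential. By [adj_coef0], (L - J) p is the right-hand side; summing over the
    vertices shows that p sums to 0, so J p = 0. *)
Lemma laplacian_potential (b : 'cV[int]_n) : \sum_v b v 0 = 0 ->
  laplacian G *m potential b = - lapJ_coef *: b.
Proof.
move=> b0; have [lG _] := dG.
have e v : (laplacian G *m potential b) v 0 - \sum_u potential b u 0 = - lapJ_coef * b v 0.
  rewrite -lapJ_mulE /potential mulmxA.
  have /eqP := adj_coef0 lapJ; rewrite addr_eq0 => /eqP ->.
  by rewrite mulNmx mul_scalar_mx !mxE mulNr.
have s0 : (\sum_u potential b u 0) *+ n = 0.
  have := laplacian_col_sum (potential b) lG.
  rewrite (eq_bigr (fun v => - lapJ_coef * b v 0 + \sum_u potential b u 0)); last first.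
    by move=> v _; rewrite -e subrK.
  by rewrite big_split /= -mulr_sumr b0 mulr0 add0r sumr_const card_ord.
apply/colP => v; rewrite [RHS]mxE -e; move/eqP: s0; rewrite mulrn_eq0.
case/orP=> /eqP => [n0|->]; last by rewrite subr0.
by have := ltn_ord v; rewrite [X in (_ < X)%N]n0.
Qed.

Lemma reachable_sum0 x y : reachable G x y -> \sum_v (y - x) v 0 = 0.
Proof.
case=> s [_ <-]; rewrite foldl_fireE addrC addKr; apply: laplacian_col_sum; by case: dG.
Qed.

(** With c = [lapJ_coef], the potential and -c times the firing counts [g] have the same image under
    L, so they differ by a constant. *)
Lemma reachable_dvd x y (u v : 'I_n) : reachable G x y ->
  (lapJ_coef %| (potential (y - x) u 0 - potential (y - x) v 0)%R)%Z.
Proof.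
move=> xy; have := laplacian_potential (reachable_sum0 xy).
case: xy => s [_ <-]; rewrite foldl_fireE addrC addKr; set g := \col_v _.
rewrite scalemxAr => /(laplacian_inj dG eG) /(_ u v); move: g (potential _) => g p.
rewrite 2!mxE => /eqP; rewrite -subr_eq0 => /eqP e.
apply/dvdzP; exists (g v 0 - g u 0); apply/eqP; rewrite -subr_eq0 -e; apply/eqP; ring.
Qed.

Variables x y : 'cV[int]_n.
Hypothesis cx : chip_distribution x.

(** The second hypothesis makes [F] the negated potential divided by [lapJ_coef], up to a constant.
    Subtracting the minimum gives the vector of [reachable_iff]; its support is where [F] is not
    minimal. *)
Lemma reachable_quot F : \sum_v (y - x) v 0 = 0 ->
  (forall u v, (F v - F u) * lapJ_coef = potential (y - x) u 0 - potential (y - x) v 0) ->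
  reachable G x y <->
  (forall W : {set 'I_n}, W \subset [set v | [exists u, F u < F v]] -> W != set0 -> ~ stuck G y W).
Proof.
(* With no vertices there is no minimum to subtract, and both sides hold. *)
move=> b0 hF; case: (posnP n) => [n0|n_gt0].
  have I0 (v : 'I_n) : False by have := ltn_ord v; rewrite [X in (_ < X)%N]n0.
  split=> _; last first.
    by rewrite (_ : y = x); [apply: reachable_refl| apply/colP => v; case: (I0 v)].
  by move=> W _ /set0Pn [v]; case: (I0 v).
have [r _ /= rmin] := @arg_minP _ _ _ (Ordinal n_gt0) xpredT F isT.
pose f : 'cV[int]_n := \col_v (F v - F r).
have f0 v : 0 <= f v 0 by rewrite mxE subr_ge0 rmin.
have fr : f r 0 = 0 by rewrite mxE subrr.
have e : y = x + laplacian G *m f.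
  apply/eqP; rewrite addrC -subr_eq; apply/eqP/colP => v.
  apply: (mulfI lapJ_coef_neq0); have [lG _] := dG.
  have -> : lapJ_coef * (y - x) v 0 = - (- lapJ_coef *: (y - x)) v 0.
    by rewrite [in RHS]mxE mulNr opprK.
  rewrite -laplacian_potential //.
  have -> : lapJ_coef * (laplacian G *m f) v 0 = (laplacian G *m (lapJ_coef *: f)) v 0.
    by rewrite -scalemxAr [RHS]mxE.
  have -> : lapJ_coef *: f = const_mx (potential (y - x) r 0) - potential (y - x).
    by apply/colP => u; rewrite mxE [f _ _]mxE mulrC hF !mxE.
  by rewrite mulmxBr laplacian_const // sub0r [in RHS]mxE.
have fE v : (f v 0 != 0) = [exists u, F u < F v].
  apply/idP/existsP => [h|[u hu]].
    by exists r; rewrite -subr_gt0 lt_def; have := f0 v; rewrite mxE => ->; move: h; rewrite mxE => ->.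
  by rewrite mxE subr_eq0 gt_eqF // (le_lt_trans _ hu) ?rmin.
rewrite (reachable_iff dG eG cx f0 fr e); split=> H W.
  by move/subsetP=> WS; apply: H => v /WS; rewrite inE fE.
by move=> WS; apply: H; apply/subsetP => v /WS; rewrite inE fE.
Qed.

End Solve.

(** * Growth of the numbers in the recursion *)

Lemma absz_sum_le (n : nat) (P : pred 'I_n) (F : 'I_n -> int) (b : nat) :
  (forall i, (`|F i| <= b)%N) -> (`|(\sum_(i | P i) F i)%R| <= n * b)%N.
Proof.
move=> Fb; rewrite -lez_nat abszE; apply: le_trans (ler_norm_sum _ _ _) _.
apply: (@le_trans _ _ (\sum_(i < n | P i) b%:Z)).
  by apply: ler_sum => i _; rewrite -abszE lez_nat.
rewrite sumr_const -mulr_natr mulrC natz -PoszM lez_nat leq_mul2r.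
by rewrite -[X in (_ <= X)%N]card_ord max_card orbT.
Qed.

Section CoefBounds.
Variables (n : nat) (A : 'M[int]_n) (W : nat).
Hypotheses (nW : (n <= W)%N) (W2 : (2 <= W)%N) (AW : forall i j, (`|A i j| <= W ^ 3)%N).

(* Each step multiplies the bound by at most 2 n^2 W^3 <= W^6. *)
Lemma char_poly_coef_bound r : (r <= n)%N ->
  (`|((char_poly A)`_(n - r))%R| <= W ^ (6 * r))%N /\
  (forall i j, (`|(A *m adj_coef A (n - r)) i j| <= W ^ (6 * r))%N) /\
  ((r < n)%N -> forall i j, (`|adj_coef A (n - r.+1) i j| <= W ^ (6 * r).+1)%N).
Proof.
have adj_step r' : (r' < n)%N -> (`|((char_poly A)`_(n - r'))%R| <= W ^ (6 * r'))%N ->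
    (forall i j, (`|(A *m adj_coef A (n - r')) i j| <= W ^ (6 * r'))%N) ->
    forall i j, (`|adj_coef A (n - r'.+1) i j| <= W ^ (6 * r').+1)%N.
  move=> rn c1 c2 i j; rewrite adj_coefS -subSn // subSS mxE [X in (_ + X)%R]mxE.
  have := c2 i j; rewrite expnS; move: (_ i j) c1 => a.
  move: ((char_poly A)`_(n - r')%N) (W ^ _)%N => c X c1 c2'.
  by case: (i == j); rewrite ?mulr1n ?mulr0n; nia.
elim: r => [|r IH] rn.
  rewrite subn0 muln0 adj_coef_ge // mulmx0.
  have h1 : (`|((char_poly A)`_n)%R| <= W ^ 0)%N.
    by have /monicP := char_poly_monic A; rewrite /lead_coef size_char_poly /= => ->.
  have h2 (i j : 'I_n) : (`|(0%R : 'M[int]_n) i j| <= W ^ 0)%N by rewrite mxE.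
  split=> //; split=> // n0; apply: (adj_step 0%N) => //; rewrite ?subn0 // adj_coef_ge // mulmx0.
  exact: h2.
have [c1 [c2 c3]] := IH (ltnW rn); have {c3} B := c3 rn.
have AB i j : (`|(A *m adj_coef A (n - r.+1)) i j| <= W ^ (6 * r + 5))%N.
  rewrite mxE; apply: (@leq_trans (n * W ^ (6 * r + 4))).
    apply: absz_sum_le => l; rewrite abszM; apply: leq_trans (leq_mul (AW _ _) (B _ _)) _.
    by rewrite -expnD leq_pexp2l //; lia.
  by rewrite (_ : 6 * r + 5 = (6 * r + 4).+1)%N ?expnS ?leq_mul2r ?nW ?orbT //; lia.
have leW a b : (a <= b)%N -> (W ^ a <= W ^ b)%N by move=> ab; rewrite leq_pexp2l //; lia.
have h1 : (`|((char_poly A)`_(n - r.+1))%R| <= W ^ (6 * r.+1))%N.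
  have := trace_mul_adj_coef A (leq_subr r.+1 n); rewrite subKn // => e.
  (* The trace is a nonzero multiple of the coefficient and so bounds it; it sums [n] diagonal
     entries, at the cost of one more factor [W]. *)
  apply: (@leq_trans (`|\tr (A *m adj_coef A (n - r.+1))|)).
    by rewrite e -mulr_natr abszM abszN leq_pmulr // natz.
  apply: (@leq_trans (n * W ^ (6 * r + 5))); first exact: absz_sum_le.
  by rewrite (_ : 6 * r.+1 = (6 * r + 5).+1)%N ?expnS ?leq_mul2r ?nW ?orbT //; lia.
have h2 i j : (`|(A *m adj_coef A (n - r.+1)) i j| <= W ^ (6 * r.+1))%N.
  by apply: leq_trans (AB i j) _; apply: leW; lia.
by split=> //; split=> // rn'; apply: adj_step.
Qed.

End CoefBounds.

(** * Burning *)

Section Burning.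
Variables (n : nat) (G : 'M[nat]_n) (y : 'cV[int]_n) (S0 : {set 'I_n}).
Implicit Types S W : {set 'I_n}.

(** The invariant of burning; if moreover [S] is stuck, then [S] is the largest stuck subset of
    [S0]. *)
Definition traps S := S \subset S0 /\ forall W, W \subset S0 -> stuck G y W -> W \subset S.

Definition burn1 S v : {set 'I_n} := if (v \in S) && ((inflow G S v)%:Z <= y v 0) then S :\ v else S.

(** The state within a round that began with [S1], after the vertices below [k] have been
    examined. *)
Definition burn_inv S1 S k := [/\ S \subset S1, traps S &
  S = S1 -> forall u : 'I_n, (u < k)%N -> u \in S -> y u 0 < (inflow G S u)%:Z].

Lemma inflow_subset W S v : W \subset S -> (inflow G W v <= inflow G S v)%N.
Proof.
move=> /subsetP WS; rewrite /inflow [leqRHS](bigID [in W]) /=.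
rewrite [X in (_ <= X + _)%N](eq_bigl [in W]) ?leq_addr // => u /=.
by case uW: (u \in W); rewrite ?andbF // WS.
Qed.

(** A burnt [v] lies in no stuck [W]: otherwise y(v) < d(W, v) <= d(S, v) <= y(v). *)
Lemma burn1_inv S1 S (v : 'I_n) : burn_inv S1 S v -> burn_inv S1 (burn1 S v) v.+1.
Proof.
case=> SS [S_S0 trS] stS; rewrite /burn1; case: ifP => [/andP [vS le]|nle].
  split=> [|| e]; last by have := subsetP SS v vS; rewrite -e !inE eqxx.
    by apply: subset_trans SS; apply: subsetDl.
  split=> [|W W0 stW]; first by apply: subset_trans S_S0; apply: subsetDl.
  have WS := trS W W0 stW; rewrite subsetD1 WS; apply/negP => vW.
  have := stW v vW; rewrite ltNge (le_trans _ le) // lez_nat.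
  exact: inflow_subset.
split=> // e u; rewrite ltnS leq_eqVlt => /orP [/eqP /val_inj -> vS|]; last exact: stS.
by move/negbT: nle; rewrite vS /= -ltNge.
Qed.

(** A round without effect occurs only at a stuck set, so otherwise each of the [t] rounds has
    removed a vertex. *)
Definition burnt S t := traps S /\ (stuck G y S \/ (#|S| + t <= n)%N).

Lemma burnt0 : burnt S0 0.
Proof. by split; [split | right; rewrite addn0 -[leqRHS]card_ord max_card]. Qed.

Lemma burnt_start S t : burnt S t -> burn_inv S S 0.
Proof. by case. Qed.

Lemma burntS S1 S t : burnt S1 t -> burn_inv S1 S n -> burnt S t.+1.
Proof.
case=> [[S1_S0 tr1] st1] [SS tr stS]; split=> //.
have [e|neS] := eqVneq S S1; first by left=> v vS; apply: stS.
case: st1 => [st1|le]; first by rewrite eqEsubset SS (proj2 tr) in neS.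
right; have : (#|S| < #|S1|)%N by apply: proper_card; rewrite properEneq neS.
lia.
Qed.

(** After [n] rounds [S] is stuck, since the alternative leaves it empty; so it is the largest stuck
    subset of [S0]. *)
Lemma burnt_decide S : burnt S n ->
  (S = set0 <-> forall W, W \subset S0 -> W != set0 -> ~ stuck G y W).
Proof.
case=> [[S_S0 tr] st]; split=> [e W W0 nW /(tr W W0)|H].
  by rewrite e subset0 (negPf nW).
apply/eqP/negPn/negP => nS; apply: (H S S_S0 nS).
case: st => // le v vS; have : (0 < #|S|)%N by rewrite card_gt0.
lia.
Qed.

End Burning.

(** * Bounded loop programs *)

(** Total functions keep array sizes and padding out of assertions; [represents] links them to
    stores. *)
Definition memory := nat -> nat -> int.

Definition setm (m : memory) a i z : memory :=
  fun b j => if (b == a) && (j == i) then z else m b j.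

Fixpoint meval (m : memory) (e : expr) : int :=
  match e with
  | Const z => z
  | Get a i => m a `|meval m i|%N
  | Bin o e1 e2 => eval_binop o (meval m e1) (meval m e2)
  end.

(** Bounded loops make the running time a recursion on the program. Branches are replaced by
    arithmetic with comparison values 0 and 1. *)
Inductive prog :=
  | PSkip
  | PSet of nat & expr & expr
  | PSeq of prog & prog
  | PFor of nat & nat & prog.

Definition cell a := Get a (Const 0).
Definition loop_cond v b := Bin OLeq (Bin OAdd (cell v) (Const 1)) (cell b).
Definition loop_incr v := Assign v (Const 0) (Bin OAdd (cell v) (Const 1)).

(* The counter of a loop is cell 0 of array v, its bound is in cell 0 of array b. *)
Fixpoint compile p : cmd :=
  match p with
  | PSkip => Skip
  | PSet a i e => Assign a i e
  | PSeq p q => Seq (compile p) (compile q)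
  | PFor v b p =>
      Seq (Assign v (Const 0) (Const 0))
          (While (loop_cond v b) (Seq (compile p) (loop_incr v)))
  end.

Fixpoint writes p : seq nat :=
  match p with
  | PSkip => [::]
  | PSet a _ _ => [:: a]
  | PSeq p q => writes p ++ writes q
  | PFor v _ p => v :: writes p
  end.

Fixpoint esize e : nat :=
  match e with
  | Const _ => 1
  | Get _ i => (esize i).+1
  | Bin _ e1 e2 => (esize e1 + esize e2).+1
  end.

(** Keeps constants within 2^K for every K >= 1, the bound that memory cells obey. *)
Fixpoint small_consts e : bool :=
  match e with
  | Const z => (`|z| <= 2)%N
  | Get _ i => small_consts i
  | Bin _ e1 e2 => small_consts e1 && small_consts e2
  end.

Section WellFormed.
Variables nA nE : nat. (* bounds on the number of arrays and on expression sizes *)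

Definition wf_expr e := small_consts e && (esize e <= nE)%N.

(** In a loop, neither the counter nor the bound is written by the body, so the number of rounds is
    fixed on entry. *)
Fixpoint wf p : bool :=
  match p with
  | PSkip => true
  | PSet a i e => [&& (a < nA)%N, wf_expr i & wf_expr e]
  | PSeq p q => wf p && wf q
  | PFor v b p =>
      [&& (v < nA)%N, v != b, v \notin writes p, b \notin writes p & wf p]
  end.
End WellFormed.

(* A round of a loop costs 14 for its test and increment, and 11 pays for the
   initialisation and the last test. *)
Fixpoint ptime N p : nat :=
  match p with
  | PSkip => 1
  | PSet _ i e => (expr_cost i + expr_cost e).+1
  | PSeq p q => ptime N p + ptime N q
  | PFor _ _ p => N * (ptime N p + 14) + 11
  end.

Lemma ptime_poly p : exists c k, forall N, (ptime N p <= c * N.+1 ^ k)%N.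
Proof.
have comb c1 k1 c2 k2 N :
    (c1 * N.+1 ^ k1 + c2 * N.+1 ^ k2 <= (c1 + c2) * N.+1 ^ (k1 + k2))%N.
  by rewrite mulnDl leq_add // leq_mul2l leq_pexp2l ?orbT // ?leq_addr ?leq_addl.
elim: p => [|a i e|p [c1 [k1 H1]] q [c2 [k2 H2]]|v b p [c [k H]]] /=.
- by exists 1%N, 0%N => N.
- by exists (expr_cost i + expr_cost e).+1, 0%N => N; rewrite muln1.
- by exists (c1 + c2)%N, (k1 + k2)%N => N; apply: leq_trans (comb _ _ _ _ _); apply: leq_add.
- exists (c + 25)%N, k.+1 => N; rewrite expnS mulnDl.
  have XN : (N.+1 <= N.+1 * N.+1 ^ k)%N by rewrite -[leqLHS]muln1 leq_mul2l expn_gt0.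
  have H1 : (N * ptime N p <= c * (N.+1 * N.+1 ^ k))%N by rewrite mulnCA leq_mul.
  lia.
Qed.

Lemma get_upd s a b i j z :
  get (upd s a i z) b j = if (b == a) && (`|j| == `|i|)%N then z else get s b j.
Proof.
rewrite /get /upd nth_set_nth /=; case: eqP => [->|//].
by rewrite nth_set_nth /=; case: eqP.
Qed.

Lemma bitlen_le z k : (`|z| <= 2 ^ k)%N -> (bitlen z <= k.+2)%N.
Proof.
move=> zk; rewrite /bitlen ltnS up_log_min // expnS mul2n -addnn -addn1 leq_add //.
by rewrite expn_gt0.
Qed.

(** Since a, b >= 1, the sum of the two bounds is at most their product, so multiplication is the
    worst case. Division by 0 yields quotient 0 and the dividend as remainder. *)
Lemma eval_binop_le o x y a b : (0 < a)%N -> (0 < b)%N ->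
  (`|x| <= 2 ^ a)%N -> (`|y| <= 2 ^ b)%N -> (`|eval_binop o x y| <= 2 ^ (a + b))%N.
Proof.
move=> a0 b0 xa yb; have a2 : (2 ^ 1 <= 2 ^ a)%N by rewrite leq_pexp2l.
have b2 : (2 ^ 1 <= 2 ^ b)%N by rewrite leq_pexp2l.
rewrite expnD; move: (2 ^ a)%N (2 ^ b)%N xa yb a2 b2 => X Y xa yb X2 Y2.
have XY : (X + Y <= X * Y)%N by nia.
case: o => /=.
- by apply: leq_trans XY; lia.
- by apply: leq_trans XY; lia.
- by rewrite abszM leq_mul.
- apply: leq_trans XY; have [->|y0] := eqVneq y 0; first by rewrite divz0.
  have := modz_ge0 x y0; have := ltz_mod x y0; have := divz_eq x y.
  move: (x %/ y)%Z (x %% y)%Z => q r e r1 r0.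
  have : (`|q| <= `|(q * y)%R|)%N by rewrite abszM leq_pmulr ?absz_gt0.
  by lia.
- apply: leq_trans XY.
  have [->|y0] := eqVneq y 0; first by rewrite modz0; lia.
  have := modz_ge0 x y0; have := ltz_mod x y0; lia.
- by case: ifP => _; nia.
- by case: ifP => _; nia.
Qed.

(** * Weakest preconditions with size bounds, and their soundness *)

Definition agree (ws : seq nat) (m m' : memory) := forall a j, a \notin ws -> m' a j = m a j.

Section Soundness.
Variables nA nE N K : nat.
Hypotheses (N_gt0 : (0 < N)%N) (K_gt0 : (0 < K)%N) (leNK : (N <= 2 ^ K)%N) (nE_ge7 : (7 <= nE)%N). (* 7 is the size of loop_cond *)

(** Besides the postcondition, addresses must stay below [N] and stored values within 2^K. A loop
    carries an invariant [I] indexed by the finished rounds; each round may assume that arrays not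
    written by the loop are as on entry. *)
Fixpoint wp p (Q : memory -> Prop) (m : memory) : Prop :=
  match p with
  | PSkip => Q m
  | PSet a i e => [/\ (`|meval m i| < N)%N, (`|meval m e| <= 2 ^ K)%N &
                      Q (setm m a `|meval m i|%N (meval m e))]
  | PSeq p q => wp p (wp q Q) m
  | PFor v b p => exists k : nat, [/\ m b 0%N = k%:Z, (k <= N)%N &
      exists I : nat -> memory -> Prop,
      [/\ I 0%N (setm m v 0 0),
          forall i m', (i < k)%N -> m' v 0%N = i%:Z -> agree (v :: writes p) m m' -> I i m' ->
            wp p (fun m'' => I i.+1 (setm m'' v 0 i.+1%:Z)) m' &
          forall m', m' v 0%N = k%:Z -> agree (v :: writes p) m m' -> I k m' -> Q m']]
  end.

Lemma wp_mono p (Q Q' : memory -> Prop) m : (forall m', Q m' -> Q' m') -> wp p Q m -> wp p Q' m.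
Proof.
elim: p Q Q' m => [|a i e|p IHp q IHq|v b p IH] Q Q' m QQ' /=.
- exact: QQ'.
- by case=> ? ? /QQ'.
- by apply: IHp => m'; apply: IHq.
- case=> k [mb kN [I [I0 IS IQ]]]; exists k; split=> //; exists I; split=> //.
  by move=> m' *; apply/QQ'/IQ.
Qed.

(** Lets a postcondition take for granted that arrays outside [writes p] are unchanged. *)
Lemma wp_frame p (Q : memory -> Prop) m :
  wp p (fun m' => agree (writes p) m m' -> Q m') m -> wp p Q m.
Proof.
elim: p Q m => [|a i e|p IHp q IHq|v b p IH] Q m /=.
- exact.
- by case=> ? ? H; split=> //; apply: H => c j; rewrite inE /setm => /negPf ->.
- move=> H; apply: IHp; apply: wp_mono H => m1 H fr1; apply: IHq; apply: wp_mono H => m2 H fr2.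
  by apply: H => a j; rewrite mem_cat negb_or => /andP [a1 a2]; rewrite fr2 // fr1.
- case=> k [mb kN [I [I0 IS IQ]]]; exists k; split=> //; exists I; split=> //.
  by move=> m' mv fr Im; apply: IQ.
Qed.

Definition represents (s : store) (m : memory) : Prop :=
  [/\ forall a i, get s a i = m a `|i|%N, (size s <= nA)%N,
      forall a, (size (nth [::] s a) <= N)%N & forall a i, (`|m a i| <= 2 ^ K)%N].

(** The bits of the store plus those of the two expressions that an assignment evaluates. *)
Definition pspace : nat := nA * (N * K.+2) + 2 * (nE * (nE * K).+2).

Lemma eval_represents s m e : represents s m -> eval s e = meval m e.
Proof. by case=> g _ _ _; elim: e => //= [a i ->|o e1 -> e2 ->]; rewrite ?g. Qed.

Lemma meval_le s m e : represents s m -> small_consts e -> (`|meval m e| <= 2 ^ (K * esize e))%N.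
Proof.
move=> [_ _ _ mle]; elim: e => [z|a i IH|o e1 IH1 e2 IH2] /=.
- by move=> z2; apply: (leq_trans z2); rewrite muln1 -{1}(expn1 2) leq_pexp2l.
- by move=> _; apply: leq_trans (mle _ _) _; rewrite leq_pexp2l // mulnS leq_addr.
- case/andP=> c1 c2; have h e : (0 < K * esize e)%N by rewrite muln_gt0 K_gt0; case: e.
  apply: leq_trans (eval_binop_le _ (h e1) (h e2) (IH1 c1) (IH2 c2)) _.
  by rewrite leq_pexp2l // -mulnDr leq_mul2l leqnSn orbT.
Qed.

Lemma expr_space_le s m e : represents s m -> wf_expr nE e ->
  (expr_space s e <= nE * (nE * K).+2)%N.
Proof.
move=> r /andP [c sz]; suff H : (expr_space s e <= esize e * (nE * K).+2)%N.
  by apply: leq_trans H _; rewrite leq_mul2r sz orbT.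
have B e' : small_consts e' -> (esize e' <= nE)%N -> (bitlen (eval s e') <= (nE * K).+2)%N.
  move=> c' sz'; rewrite (eval_represents _ r); apply: bitlen_le.
  apply: leq_trans (meval_le r c') _.
  by rewrite leq_pexp2l // mulnC leq_mul2r sz' orbT.
elim: e c sz => [z|a i IH|o e1 IH1 e2 IH2] c sz.
- by rewrite /= addn0 mul1n; apply: (B (Const z)).
- have c' : small_consts i := c.
  by rewrite [expr_space _ _]/= mulSn leq_add ?(B (Get a i)) // IH // ltnW.
- have /andP [c1 c2] : small_consts e1 && small_consts e2 := c.
  have sz' : (esize e1 + esize e2 < nE)%N := sz.
  rewrite [expr_space _ _]/= mulSn mulnDl leq_add ?(B (Bin o e1 e2)) // leq_add ?IH1 ?IH2 //.
    by apply: leq_trans (ltnW sz'); apply: leq_addr.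
  by apply: leq_trans (ltnW sz'); apply: leq_addl.
Qed.

Lemma bit_size_le s m : represents s m -> (bit_size s <= nA * (N * K.+2))%N.
Proof.
case=> g sA sN mle; rewrite /bit_size.
have H (T : eqType) (l : seq T) (F : T -> nat) k b : (size l <= k)%N ->
    (forall x, x \in l -> (F x <= b)%N) -> (\sum_(x <- l) F x <= k * b)%N.
  move=> lk Fb; apply: (@leq_trans (size l * b)); last by rewrite leq_mul2r lk orbT.
  rewrite -sum1_size big_distrl /= big_seq [leqRHS]big_seq.
  by apply: leq_sum => x xl; rewrite mul1n Fb.
apply: (H) => // l /(nthP [::]) [a _ <-]; apply: (H) => // z /(nthP 0) [i _ <-].
by apply: bitlen_le; have := mle a i; rewrite -(g a i%:Z).
Qed.

Lemma represents_upd s m a i z : represents s m -> (a < nA)%N -> (`|i| < N)%N -> (`|z| <= 2 ^ K)%N ->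
  represents (upd s a i z) (setm m a `|i|%N z).
Proof.
case=> g sA sN mle aA iN zK; split.
- by move=> b j; rewrite get_upd /setm g.
- by rewrite /upd size_set_nth geq_max aA.
- move=> b; rewrite /upd nth_set_nth /=; case: eqP => // _.
  by rewrite size_set_nth geq_max iN sN.
- by move=> b j; rewrite /setm; case: ifP.
Qed.

Lemma exec_compile p (Q : memory -> Prop) s m : wf nA nE p -> represents s m -> wp p Q m ->
  exists t M s' m', [/\ exec (compile p) s t M s', (t <= ptime N p)%N, (M <= pspace)%N,
     represents s' m' & Q m' /\ agree (writes p) m m'].
Proof.
have wfc v : wf_expr nE (cell v) by rewrite /wf_expr /= (leq_trans _ nE_ge7).
have wfk z : (`|z| <= 2)%N -> wf_expr nE (Const z).
  by rewrite /wf_expr /= => -> ; rewrite (leq_trans _ nE_ge7).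
have wfi v : wf_expr nE (Bin OAdd (cell v) (Const 1)) by rewrite /wf_expr /= (leq_trans _ nE_ge7).
have wfl v b : wf_expr nE (loop_cond v b) by rewrite /wf_expr /= (leq_trans _ nE_ge7).
have sp1 s0 m0 e : represents s0 m0 -> wf_expr nE e -> (bit_size s0 + expr_space s0 e <= pspace)%N.
  move=> r we; rewrite /pspace leq_add ?(bit_size_le r) //.
  by apply: leq_trans (expr_space_le r we) _; rewrite leq_pmull.
have sp2 s0 m0 e e' : represents s0 m0 -> wf_expr nE e -> wf_expr nE e' ->
    (bit_size s0 + expr_space s0 e + expr_space s0 e' <= pspace)%N.
  move=> r we we'; rewrite /pspace -addnA leq_add ?(bit_size_le r) //.
  by rewrite mul2n -addnn leq_add // (expr_space_le r).
have sp0 s0 m0 : represents s0 m0 -> (bit_size s0 <= pspace)%N.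
  by move=> r; apply: leq_trans (bit_size_le r) _; apply: leq_addr.
have asg s0 m0 a i e : represents s0 m0 -> (a < nA)%N -> wf_expr nE i -> wf_expr nE e ->
    (`|meval m0 i| < N)%N -> (`|meval m0 e| <= 2 ^ K)%N ->
    exists2 M, exec (Assign a i e) s0 (expr_cost i + expr_cost e).+1 M
                    (upd s0 a (meval m0 i) (meval m0 e)) & (M <= pspace)%N.
  move=> r aA wi we iN eK; have := ExecAssign s0 a i e; rewrite /= !(eval_represents _ r) => E.
  eexists; first exact: E.
  by rewrite geq_max (sp2 _ _ _ _ r) // (sp0 _ _ (represents_upd r aA iN eK)).
elim: p Q s m => [|a i e|p IHp q IHq|v b p IH] Q s m /= w r H.
- by exists 1%N, (bit_size s), s, m; split; [exact: ExecSkip| | exact: sp0 r| |].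
- case/and3P: w => aA wi we; case: H => iN eK HQ.
  have [M E hM] := asg _ _ _ _ _ r aA wi we iN eK.
  do 4 eexists; split; [exact: E| by []| by []| exact: (represents_upd r aA iN eK)|].
  by split=> // c j; rewrite inE /setm => /negPf ->.
- case/andP: w => wp1 wq; have [t1 [M1 [s1 [m1 [E1 T1 S1 r1 [Q1 F1]]]]]] := IHp _ _ _ wp1 r H.
  have [t2 [M2 [s2 [m2 [E2 T2 S2 r2 [Q2 F2]]]]]] := IHq _ _ _ wq r1 Q1.
  do 4 eexists; split; [exact: ExecSeq E1 E2| exact: leq_add| by rewrite geq_max S1| exact: r2|].
  by split=> // c j; rewrite mem_cat negb_or => /andP [c1 c2]; rewrite F2 // F1.
- case/and5P: w => vA vb vp bp wp1; case: H => k [mb kN [I [I0 IS IQ]]].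
  set fr := agree (v :: writes p) m in IS IQ.
  have bv : b \notin v :: writes p by rewrite inE negb_or eq_sym vb.
  (* Induction on the remaining rounds k - i; the 8 pays for the last, failing test. *)
  have loop i s0 m0 : (i <= k)%N -> represents s0 m0 -> m0 v 0%N = i%:Z -> fr m0 -> I i m0 ->
      exists t M s' m', [/\ exec (While (loop_cond v b) (Seq (compile p) (loop_incr v))) s0 t M s',
        (t <= (k - i) * (ptime N p + 14) + 8)%N, (M <= pspace)%N, represents s' m' & Q m' /\ fr m'].
    have [d] := ubnP (k - i); elim: d i s0 m0 => // d IHd i s0 m0; rewrite ltnS => kd ik r0 mi fr0 Ii.
    have Ec : eval s0 (loop_cond v b) = if (i < k)%N then 1 else 0.
      by rewrite (eval_represents _ r0) /= mi (fr0 b) // mb -PoszD lez_nat addn1.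
    case: (ltnP i k) Ec => [ltik|leki] Ec.
    + have [t1 [M1 [s1 [m1 [E1 T1 S1 r1 [Q1 F1]]]]]] := IH _ _ _ wp1 r0 (IS i m0 ltik mi fr0 Ii).
      have m1v : m1 v 0%N = i%:Z by rewrite F1.
      have e1 : meval m1 (Bin OAdd (cell v) (Const 1)) = i.+1%:Z.
        by rewrite /= m1v -PoszD addn1.
      have iK : (`|i.+1%:Z| <= 2 ^ K)%N by apply: leq_trans leNK; apply: leq_trans kN.
      have [||M2 E2 S2] := asg s1 m1 v (Const 0) _ r1 vA (wfk 0 isT) (wfi v); rewrite ?e1 //.
      rewrite e1 in E2; have r2 := @represents_upd _ _ v 0 i.+1%:Z r1 vA N_gt0 iK.
      have [|||||t3 [M3 [s3 [m3 [E3 T3 S3 r3 Q3]]]]] := IHd i.+1 _ _ _ _ r2 => //.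
      * by move: kd ltik; lia.
      * by rewrite /setm !eqxx.
      * move=> c j cw; rewrite /setm; move: (cw); rewrite inE negb_or => /andP [/negPf -> cp].
        by rewrite /= F1 // fr0.
      do 4 eexists; split; [apply: (ExecWhileTrue _ (ExecSeq E1 E2) E3); by rewrite Ec| | | exact: r3| by []].
        have -> : (k - i = (k - i.+1).+1)%N by move: ltik; lia.
        by rewrite mulSn /=; move: T1 T3; lia.
      by rewrite !geq_max (sp1 _ _ _ r0) // S1 S2 S3.
    + have ek : i = k by apply/eqP; rewrite eqn_leq ik.
      rewrite ek in mi Ii; do 4 eexists; split; [exact: ExecWhileFalse| by rewrite leq_addl| | exact: r0|].
        exact: sp1 r0 _.
      by split=> //; apply: IQ.
  have [||M1 E1 S1] := asg s m v (Const 0) (Const 0) r vA (wfk 0 isT) (wfk 0 isT) => //.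
  have r1 := @represents_upd _ _ v 0 0 r vA N_gt0 (leq0n _).
  have [|||t2 [M2 [s2 [m2 [E2 T2 S2 r2 Q2]]]]] := loop 0%N _ _ (leq0n _) r1 => //.
  + by rewrite /setm !eqxx.
  + by move=> c j; rewrite inE negb_or /setm => /andP [/negPf -> _].
  do 4 eexists; split; [exact: ExecSeq E1 E2| | by rewrite geq_max S1| exact: r2| by []].
  rewrite subn0 in T2; rewrite /= [leqRHS]addnC -[11%N]/(3 + 8)%N -addnA leq_add2l.
  apply: leq_trans T2 _; rewrite addnC leq_add2l leq_mul2r kN orbT //.
Qed.

End Soundness.

(* Arrays 6 and 8 hold the loop counter and the accumulator of sums, array 5
   the counter of the loops over the n^2 (array 4) positions of a matrix. *)
Definition psum e :=
  PSeq (PSet 8 (Const 0) (Const 0)) (PFor 6 0 (PSet 8 (Const 0) (Bin OAdd (cell 8) e))).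
Definition mapfor v b arr body e := PFor v b (PSeq body (PSet arr (cell v) e)).
Definition row_expr := Bin OQuo (cell 5) (cell 0).
Definition col_expr := Bin ORem (cell 5) (cell 0).
Definition mx_get a i j := Get a (Bin OAdd (Bin OMul i (cell 0)) j).

(** * Rules for sums, arrays and loops *)

Section Macros.
Variables (n N K : nat).
Hypothesis nN : (n * n < N)%N.
Implicit Types (m : memory) (Q : memory -> Prop).
Local Notation wp := (wp N K).

Definition holds_mx m a (M : 'I_n -> 'I_n -> int) := forall i j : 'I_n, m a (i * n + j)%N = M i j.
Definition holds_vec m a (F : 'I_n -> int) := forall i : 'I_n, m a i = F i.

Lemma holds_mx_agree ws m m' a M : agree ws m m' -> holds_mx m a M -> a \notin ws -> holds_mx m' a M.
Proof. by move=> h H aw i j; rewrite h. Qed.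

Lemma holds_vec_agree ws m m' a F : agree ws m m' -> holds_vec m a F -> a \notin ws -> holds_vec m' a F.
Proof. by move=> h H aw i; rewrite h. Qed.

Lemma mx_getE m a ei ej (i j : 'I_n) M : m 0%N 0%N = n%:Z -> meval m ei = i%:Z ->
  meval m ej = j%:Z -> holds_mx m a M -> meval m (mx_get a ei ej) = M i j.
Proof. by move=> m0 /= -> -> H; rewrite m0 -PoszM -PoszD /= H. Qed.

Lemma row_exprE m (i j : 'I_n) : m 0%N 0%N = n%:Z -> m 5 0%N = (i * n + j)%N%:Z ->
  meval m row_expr = i%:Z.
Proof.
move=> m0 m5; rewrite /= m0 m5 divz_nat divnMDl ?divn_small ?addn0 //.
exact: leq_ltn_trans (ltn_ord i).
Qed.

Lemma col_exprE m (i j : 'I_n) : m 0%N 0%N = n%:Z -> m 5 0%N = (i * n + j)%N%:Z ->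
  meval m col_expr = j%:Z.
Proof. by move=> m0 m5; rewrite /= m0 m5 modz_nat modnMDl modn_small. Qed.

Lemma wp_seq p q (R : memory -> Prop) Q m : wp p R m ->
  (forall m', agree (writes p) m m' -> R m' -> wp q Q m') -> wp (PSeq p q) Q m.
Proof. by move=> H1 H2; apply: (@wp_frame N K p); apply: wp_mono H1 => m' R' fr; apply: H2. Qed.

(** The list [[:: 8; 6; 8]] is [writes (psum e)]. Every partial sum is at most n b in absolute
    value, which is what must fit into 2^K. *)
Lemma wp_psum e (F : 'I_n -> int) b m : m 0%N 0%N = n%:Z ->
  (forall (i : 'I_n) m', m' 6 0%N = i%:Z -> agree [:: 8; 6; 8] m m' -> meval m' e = F i) ->
  (forall i, `|F i| <= b)%N -> (n * b <= 2 ^ K)%N ->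
  wp (psum e) (fun m' => m' 8 0%N = \sum_i F i) m.
Proof.
move=> m0 He Fb nb; split=> //; first exact: leq_ltn_trans nN.
have n_le_N : (n <= N)%N by apply: leq_trans (ltnW nN); case: (n) => // k; rewrite leq_pmull.
set m1 := setm m _ _ _; exists n; split=> //.
exists (fun k m' => m' 8 0%N = \sum_(i < n | (i < k)%N) F i); split.
- by rewrite big1.
- move=> k m' kn m'6 fr m'8.
  have fr0 : agree [:: 8; 6; 8] m m'.
    move=> a j; rewrite !inE !negb_or => /and3P [a8 a6 _].
    by rewrite fr ?inE ?negb_or ?a6 ?a8 // /m1 /setm (negPf a8).
  have E : meval m' (Bin OAdd (cell 8) e) = \sum_(i < n | (i < k.+1)%N) F i.
    rewrite /= m'8 (He (Ordinal kn)) // [RHS](bigD1 (Ordinal kn)) //= addrC; congr (_ + _).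
    by apply: eq_bigl => i; rewrite ltnS -val_eqE /= ltn_neqAle andbC.
  split; first exact: leq_ltn_trans nN.
    by rewrite E; apply: leq_trans nb; apply: absz_sum_le.
  by move: E; rewrite /setm /=.
- by move=> m' _ _ ->; apply: eq_bigl => i; rewrite ltn_ord.
Qed.

Lemma wp_mapfor v b arr body e k (Pr : nat -> int -> Prop) m :
  v != arr -> v \notin writes body -> arr \notin writes body -> m b 0%N = k%:Z -> (k < N)%N ->
  (forall i m', (i < k)%N -> m' v 0%N = i%:Z -> agree (v :: writes body ++ [:: arr]) m m' ->
    wp body (fun m'' => (`|meval m'' e| <= 2 ^ K)%N /\ Pr i (meval m'' e)) m') ->
  wp (mapfor v b arr body e) (fun m' => forall i, (i < k)%N -> Pr i (m' arr i)) m.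
Proof.
move=> va vb ab mb kN H; exists k; split=> //; first exact: ltnW.
exists (fun i m' => forall i', (i' < i)%N -> Pr i' (m' arr i')); split=> //.
move=> i m' ik mi fr Ii; apply: wp_frame; apply: wp_seq (H i m' ik mi fr) _.
move=> m1 fr1 [h1 h2]; have m1v : m1 v 0%N = i%:Z by rewrite fr1.
rewrite /= m1v; split=> //; first exact: ltn_trans kN.
move=> fr2 i'; rewrite ltnS leq_eqVlt /setm => /orP [/eqP ->|i'i].
  by rewrite eq_sym (negPf va) /= !eqxx.
by rewrite eq_sym (negPf va) /= eqxx (ltn_eqF i'i) /= fr1 //; apply: Ii.
Qed.

Lemma wp_mapfor_mx arr body e (M : 'I_n -> 'I_n -> int) m :
  5%N != arr -> 5%N \notin writes body -> arr \notin writes body -> m 4 0%N = (n * n)%N%:Z ->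
  (forall i j, `|M i j| <= 2 ^ K)%N ->
  (forall (i j : 'I_n) m', m' 5 0%N = (i * n + j)%N%:Z ->
     agree (5%N :: writes body ++ [:: arr]) m m' -> wp body (fun m'' => meval m'' e = M i j) m') ->
  wp (mapfor 5 4 arr body e) (fun m' => holds_mx m' arr M) m.
Proof.
move=> va vb ab m4 Mb H.
pose Pr q z := forall i j : 'I_n, q = (i * n + j)%N -> z = M i j.
apply: wp_mono (@wp_mapfor 5 4 arr body e _ Pr m va vb ab m4 nN _) => [m' Hm i j|q m' qn mq fr].
  apply: Hm => //; apply: leq_trans (_ : i.+1 * n <= _)%N; last by rewrite leq_mul2r ltn_ord orbT.
  by rewrite mulSn addnC ltn_add2r.
have n0 : (0 < n)%N by move: qn; case: n.
have iq : (q %/ n < n)%N by rewrite ltn_divLR.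
have jq : (q %% n < n)%N by rewrite ltn_mod.
have e1 : q = (Ordinal iq * n + Ordinal jq)%N by rewrite /= -divn_eq.
apply: wp_mono (H (Ordinal iq) (Ordinal jq) m' _ fr) => [m'' ->|]; last by rewrite -e1.
split=> // i j eq; have eqn : (i * n + j = q)%N by [].
have ei : i = Ordinal iq by apply: val_inj; rewrite /= -eqn divnMDl // divn_small ?addn0.
have ej : j = Ordinal jq by apply: val_inj; rewrite /= -eqn modnMDl modn_small.
by rewrite ei ej.
Qed.

Lemma wp_mapfor_vec arr body e (F : 'I_n -> int) m :
  17%N != arr -> 17%N \notin writes body -> arr \notin writes body -> m 0%N 0%N = n%:Z ->
  (forall i, `|F i| <= 2 ^ K)%N ->
  (forall (i : 'I_n) m', m' 17 0%N = i%:Z ->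
     agree (17%N :: writes body ++ [:: arr]) m m' -> wp body (fun m'' => meval m'' e = F i) m') ->
  wp (mapfor 17 0 arr body e) (fun m' => holds_vec m' arr F) m.
Proof.
move=> va vb ab m0 Fb H; have nN' : (n < N)%N by apply: leq_ltn_trans nN; case: n => // k; rewrite leq_pmull.
pose Pr q z := forall i : 'I_n, q = i :> nat -> z = F i.
apply: wp_mono (@wp_mapfor 17 0 arr body e _ Pr m va vb ab m0 nN' _) => [m' Hm i|q m' qn mq fr].
  by apply: Hm.
apply: wp_mono (H (Ordinal qn) m' mq fr) => [m'' ->]; split=> // i qi.
by congr F; apply: val_inj.
Qed.

(** For invariants that do not depend on the loop counter. *)
Lemma wp_for v b p k (I : nat -> memory -> Prop) m : m b 0%N = k%:Z -> (k <= N)%N ->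
  (forall i m' z, I i m' -> I i (setm m' v 0 z)) -> I 0%N m ->
  (forall i m', (i < k)%N -> m' v 0%N = i%:Z -> agree (v :: writes p) m m' -> I i m' ->
     wp p (I i.+1) m') ->
  wp (PFor v b p) (I k) m.
Proof.
move=> mb kN Iv I0 IS; exists k; split=> //; exists I; split=> //; first exact: Iv.
by move=> i m' ik mi fr Ii; apply: wp_mono (IS i m' ik mi fr Ii) => m''; apply: Iv.
Qed.

Lemma wp_set1 a i e m (z : int) k : meval m i = k%:Z -> (k < N)%N -> meval m e = z ->
  (`|z| <= 2 ^ K)%N -> wp (PSet a i e) (fun m' => m' = setm m a k z) m.
Proof. by move=> /= -> ? ->. Qed.

Lemma wp_set0 a e m (z : int) : meval m e = z -> (`|z| <= 2 ^ K)%N ->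
  wp (PSet a (Const 0) e) (fun m' => m' = setm m a 0 z) m.
Proof. by move=> E zK; apply: (@wp_set1 _ _ _ _ _ 0%N) => //; apply: leq_ltn_trans nN. Qed.

End Macros.

(** * The decision program *)

Local Notation eadd := (Bin OAdd).
Local Notation esub := (Bin OSub).
Local Notation emul := (Bin OMul).
Local Notation equo := (Bin OQuo).
Local Notation ele := (Bin OLeq).
Local Notation eeq := (Bin OEq).
Local Notation e0 := (Const 0).
Local Notation e1 := (Const 1).

(** Array 8 gets the out-degree of the row vertex, to be subtracted on the diagonal, where the
    adjacency matrix is 0. *)
Definition set_lapJ :=
  mapfor 5 4 9 (psum (mx_get 1 row_expr (cell 6)))
    (esub (esub (mx_get 1 col_expr row_expr) e1) (emul (eeq row_expr col_expr) (cell 8))).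

Definition set_adj :=
  mapfor 5 4 10 PSkip (eadd (mx_get 11 row_expr col_expr) (emul (eeq row_expr col_expr) (cell 12))).

Definition set_prod :=
  mapfor 5 4 11 (psum (emul (mx_get 9 row_expr (cell 6)) (mx_get 10 (cell 6) col_expr))) (cell 8).

Definition set_coef :=
  PSeq (psum (mx_get 11 (cell 6) (cell 6)))
       (PSet 12 e0 (equo (esub e0 (cell 8)) (eadd (cell 7) e1))).

(** Round r takes (L - J) B_(n-r) and coefficient n - r to B_(n-r-1), then to its product and
    coefficient, where B_k is [adj_coef] of L - J at k. The start is B_n = 0 and the leading
    coefficient 1; array 11 is 0 because it was never written. *)
Definition faddeev_leverrier := PFor 7 0 (PSeq set_adj (PSeq set_prod set_coef)).

Definition set_potential :=
  mapfor 17 0 13 (psum (emul (mx_get 10 (cell 17) (cell 6))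
                           (esub (Get 3 (cell 6)) (Get 2 (cell 6))))) (cell 8).

Definition set_firing :=
  mapfor 17 0 14 PSkip (equo (esub (Get 13 e0) (Get 13 (cell 17))) (cell 12)).

(** Counts the vertices with a strictly smaller value; the support is where this count is at least
    1. *)
Definition set_support :=
  mapfor 17 0 15 (psum (ele (eadd (Get 14 (cell 6)) e1) (Get 14 (cell 17)))) (ele e1 (cell 8)).

(** The membership bit of the vertex v in cell 17 survives exactly if y(v) < d(S, v), where S is the
    current set. *)
Definition burn_step :=
  PSeq (psum (emul (Get 15 (cell 6)) (mx_get 1 (cell 6) (cell 17))))
       (PSet 15 (cell 17) (emul (Get 15 (cell 17)) (ele (eadd (Get 3 (cell 17)) e1) (cell 8)))).

Definition burn := PFor 7 0 (PFor 17 0 burn_step).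

Definition check_zero e := PSeq (psum e) (PSet 16 e0 (emul (cell 16) (eeq (cell 8) e0))).

Definition check_sum := check_zero (esub (Get 3 (cell 6)) (Get 2 (cell 6))).

(** Sums to the number of vertices at which the division in [set_firing] leaves a remainder. *)
Definition check_dvd :=
  check_zero (esub e1 (eeq (emul (Get 14 (cell 6)) (cell 12))
                           (esub (Get 13 e0) (Get 13 (cell 6))))).

Definition check_burnt := check_zero (Get 15 (cell 6)).

(* Arrays: 4 holds n^2, 9 the matrix L - J, 10 and 11 the recursion matrix B and
   the product (L - J) B, 12 the current coefficient of the characteristic
   polynomial, 13 the potential, 14 the firing vector up to a constant, 15 the
   support, 16 the answer; 7 and 17 are loop counters. *)
Definition decide_reach :=
  PSeq (PSet 4 e0 (emul (cell 0) (cell 0)))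
  (PSeq (PSet 12 e0 e1)
  (PSeq (PSet 16 e0 e1)
  (PSeq set_lapJ
  (PSeq faddeev_leverrier
  (PSeq check_sum
  (PSeq set_potential
  (PSeq set_firing
  (PSeq check_dvd
  (PSeq set_support
  (PSeq burn
  (PSeq check_burnt
        (PSet 0 e0 (cell 16))))))))))))).

(** The arrays are 0 to 17, and no expression has size above 40. *)
Lemma wf_decide_reach : wf 18 40 decide_reach.
Proof. by []. Qed.

(** * Correctness of the decision program *)

Section Run.
Variables (n : nat) (G : 'M[nat]_n) (x y : 'cV[int]_n) (W N K : nat).
Hypotheses (dG : digraph G) (eG : eulerian G) (cx : chip_distribution x).
Hypotheses (W8 : (8 <= W)%N) (nW : (n <= W)%N) (GW : forall u v, (G u v <= W)%N)
  (xW : forall v, (`|x v 0%R| <= W)%N) (yW : forall v, (`|y v 0%R| <= W)%N).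
Hypotheses (nN : (n * n < N)%N) (NK : (N <= 2 ^ K)%N) (WK : (W ^ (6 * n + 6) <= 2 ^ K)%N).
Implicit Types (m : memory).
Local Notation wp := (wp N K).
Local Notation A := (lapJ G).
Local Notation adjc r := (adj_coef A (n - r)%N).
Local Notation chi r := ((char_poly A)`_(n - r)%N).
Local Notation pot := (potential G (y - x)).

Definition inputs m := [/\ m 0%N 0%N = n%:Z, m 4 0%N = (n * n)%N%:Z,
  holds_mx m 1 (fun u v => (G u v)%:Z), holds_vec m 2 (fun v => x v 0)
  & holds_vec m 3 (fun v => y v 0)].

Lemma inputs_agree ws m m' : agree ws m m' -> all (fun a => a > 4)%N ws ->
  inputs m -> inputs m'.
Proof.
move=> fr /allP ws4; have nws a : (a <= 4)%N -> a \notin ws.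
  by move=> a4; apply/negP => /ws4 /=; rewrite ltnNge a4.
case=> i0 i4 i1 i2 i3; split; rewrite ?fr ?nws //.
- exact: (holds_mx_agree fr i1 (nws _ _)).
- exact: (holds_vec_agree fr i2 (nws _ _)).
- exact: (holds_vec_agree fr i3 (nws _ _)).
Qed.

(** The bounds on stored values are powers of [W]; the largest exponent that occurs is 6 n + 4, for
    the firing vector. *)
Lemma leWK a : (a <= 6 * n + 6)%N -> (W ^ a <= 2 ^ K)%N.
Proof. by move=> h; apply: leq_trans WK; rewrite leq_pexp2l //; lia. Qed.

Lemma lapJE u v : A u v = (G v u)%:Z - 1 - (u == v)%:Z * (outdeg G u)%:Z.
Proof.
have [lG _] := dG; rewrite !mxE; case: eqP => [->|_]; first by rewrite lG mul1r sub0r addrC.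
by rewrite mul0r subr0.
Qed.

Lemma outdeg_le u : (outdeg G u <= W ^ 2)%N.
Proof.
apply: (@leq_trans (n * W)); last by rewrite leq_mul2r nW orbT.
rewrite -[n in (n * _)%N]card_ord -sum_nat_const; exact: leq_sum.
Qed.

Lemma lapJ_le u v : (`|A u v| <= W ^ 3)%N.
Proof.
have := outdeg_le u; have := GW v u; rewrite lapJE; move: (outdeg G u) (G v u) => d g h1 h2.
apply: (@leq_trans (W + 1 + W ^ 2)); first by case: (u == v); rewrite ?mul1r ?mul0r; lia.
by rewrite !expnS expn0 !muln1; nia.
Qed.

Lemma meval_eq m a b (i j : 'I_n) : meval m a = i%:Z -> meval m b = j%:Z ->
  meval m (eeq a b) = (i == j)%:Z.
Proof. by move=> /= -> ->; rewrite -val_eqE eqz_nat; case: (_ == _). Qed.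

Lemma wp_set_lapJ m : inputs m -> wp set_lapJ (fun m' => holds_mx m' 9 A) m.
Proof.
move=> inp; have [m0 m4 m1 _ _] := inp.
apply: (wp_mapfor_mx nN) => // [i j|i j m' m'5 fr].
  by apply: leq_trans (lapJ_le i j) _; apply: leWK; lia.
have [m'0 _ m'1 _ _] := inputs_agree fr isT inp.
apply: (@wp_frame N K (psum _)).
apply: wp_mono (wp_psum nN (F := fun l => (G i l)%:Z) (b := W) m'0 _ _ _) => [m2 m28 fr2|l m2 m26 fr2|l|].
- have [m20 _ m21 _ _] := inputs_agree fr2 isT (inputs_agree fr isT inp).
  have m25 : m2 5 0%N = (i * n + j)%N%:Z by rewrite fr2.
  have rE := row_exprE m20 m25; have cE := col_exprE m20 m25.
  have := mx_getE m20 cE rE m21; have := meval_eq rE cE.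
  rewrite lapJE /outdeg sum_Posz -m28; move: (mx_get _ _ _) (eeq _ _) => ea eb.
  by rewrite /= => -> ->.
- have [m20 _ m21 _ _] := inputs_agree fr2 isT (inputs_agree fr isT inp).
  by rewrite (@mx_getE _ _ _ _ _ i l _ m20 _ _ m21) //; apply: (row_exprE (j := j) m20); rewrite fr2.
- exact: GW.
- by apply: leq_trans (leWK (_ : 2 <= _)%N); [rewrite leq_mul2r nW orbT|lia].
Qed.

Lemma adjcS r : (r < n)%N -> adjc r.+1 = A *m adjc r + (chi r)%:M.
Proof. by move=> rn; rewrite adj_coefS -subSn // subSS. Qed.

Let W2 : (2 <= W)%N. Proof. by apply: leq_trans W8. Qed.
Let nleN : (n <= N)%N.
Proof. by apply: leq_trans (ltnW nN); case: (n) => // k; rewrite leq_pmull. Qed.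

Lemma nWle a : (n * W ^ a <= W ^ a.+1)%N.
Proof. by rewrite expnS leq_mul2r nW orbT. Qed.

Lemma wp_set_adj r m : (r < n)%N -> inputs m -> holds_mx m 11 (A *m adjc r) ->
  m 12 0%N = chi r -> wp set_adj (fun m' => holds_mx m' 10 (adjc r.+1)) m.
Proof.
move=> rn inp mP mc; have [m0 m4 _ _ _] := inp.
have [_ [_ B]] := char_poly_coef_bound nW W2 lapJ_le (ltnW rn).
apply: (wp_mapfor_mx nN) => // [i j|i j m' m'5 fr].
  by apply: leq_trans (B rn i j) _; apply: leWK; lia.
have [m'0 _ _ _ _] := inputs_agree fr isT inp.
have rE := row_exprE m'0 m'5; have cE := col_exprE m'0 m'5.
have := mx_getE m'0 rE cE (holds_mx_agree fr mP isT); have := meval_eq rE cE.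
move: (mx_get _ _ _) (eeq _ _) => ea eb; rewrite /= => -> ->; rewrite fr // mc adjcS // [RHS]mxE.
by rewrite [X in _ = _ + X]mxE; case: (i == j); rewrite ?mul1r ?mul0r.
Qed.

Lemma wp_set_prod r m : (r < n)%N -> inputs m -> holds_mx m 9 A ->
  holds_mx m 10 (adjc r.+1) -> wp set_prod (fun m' => holds_mx m' 11 (A *m adjc r.+1)) m.
Proof.
move=> rn inp mA mB; have [m0 m4 _ _ _] := inp.
have [_ [_ B]] := char_poly_coef_bound nW W2 lapJ_le (ltnW rn).
have [_ [P _]] := char_poly_coef_bound nW W2 lapJ_le rn.
apply: (wp_mapfor_mx nN) => // [i j|i j m' m'5 fr].
  by apply: leq_trans (P i j) _; apply: leWK; lia.
have [m'0 _ _ _ _] := inputs_agree fr isT inp.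
apply: wp_mono (wp_psum nN (F := fun l => A i l * adjc r.+1 l j) (b := W ^ (6 * r + 4)) m'0 _ _ _)
  => [m2 m28|l m2 m26 fr2|l|].
- by rewrite /= m28 mxE.
- have [m20 _ _ _ _] := inputs_agree fr2 isT (inputs_agree fr isT inp).
  have m25 : m2 5 0%N = (i * n + j)%N%:Z by rewrite fr2.
  have rE := row_exprE m20 m25; have cE := col_exprE m20 m25.
  have lE : meval m2 (cell 6) = l%:Z := m26.
  have := mx_getE m20 rE lE (holds_mx_agree fr2 (holds_mx_agree fr mA isT) isT).
  have := mx_getE m20 lE cE (holds_mx_agree fr2 (holds_mx_agree fr mB isT) isT).
  by move: (mx_get _ _ _) (mx_get _ _ _) => ea eb /= -> ->.
- rewrite abszM; apply: leq_trans (leq_mul (lapJ_le _ _) (B rn _ _)) _.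
  by rewrite -expnD leq_pexp2l //; lia.
- by apply: leq_trans (nWle _) _; apply: leWK; lia.
Qed.

Lemma wp_set_coef r m : (r < n)%N -> inputs m -> m 7 0%N = r%:Z ->
  holds_mx m 11 (A *m adjc r.+1) -> wp set_coef (fun m' => m' 12 0%N = chi r.+1) m.
Proof.
move=> rn inp m7 mP; have [m0 _ _ _ _] := inp.
have [C [P _]] := char_poly_coef_bound nW W2 lapJ_le rn.
apply: (wp_seq (wp_psum nN (F := fun l => (A *m adjc r.+1) l l) (b := W ^ (6 * r.+1)) m0 _ _ _))
  => [m' m'6 l fr|l|| m' fr m'8].
- have [m'0 _ _ _ _] := inputs_agree fr isT inp.
  by rewrite (@mx_getE _ _ _ _ _ m' m' _ m'0 _ _ (holds_mx_agree fr mP isT)).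
- exact: P.
- by apply: leq_trans (nWle _) _; apply: leWK; lia.
- have := trace_mul_adj_coef A (leq_subr r.+1 n); rewrite subKn // => tr.
  have E : meval m' (equo (esub e0 (cell 8)) (eadd (cell 7) e1)) = chi r.+1.
    rewrite /= m'8 fr // m7 -/(mxtrace _) tr sub0r mulNrn opprK -mulr_natr natz -PoszD addn1.
    by rewrite mulzK.
  apply: wp_mono (wp_set0 nN 12 E _) => [m2 -> //|].
  by apply: leq_trans C _; apply: leWK; lia.
Qed.

Lemma wp_faddeev_leverrier m : inputs m -> holds_mx m 9 A -> (forall q, m 11 q = 0) ->
  m 12 0%N = 1 ->
  wp faddeev_leverrier (fun m' => holds_mx m' 10 (adj_coef A 0) /\ m' 12 0%N = lapJ_coef G) m.
Proof.
move=> inp mA m11 m12; have [m0 _ _ _ _] := inp.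
(* Array 10 is first set in round 0, hence the guard; at the end any matrix index witnesses 0 <
   n. *)
pose I r m' := [/\ holds_mx m' 11 (A *m adjc r), m' 12 0%N = chi r &
                    ((0 < r)%N -> holds_mx m' 10 (adjc r))].
apply: (@wp_mono N K faddeev_leverrier (I n)) => [m' [_ c B]|].
  rewrite subnn in c B; split=> // i j; apply: B; exact: leq_ltn_trans (ltn_ord i).
apply: wp_for => //.
  split=> // [i j|].
    by rewrite m11 subn0 adj_coef_ge // mulmx0 mxE.
  rewrite m12 subn0; have /monicP := char_poly_monic A.
  by rewrite /lead_coef size_char_poly.
move=> r m' rn m'7 fr [mP mc _].
have inp' := inputs_agree fr isT inp; have mA' := holds_mx_agree fr mA isT.
apply: (wp_seq (wp_set_adj rn inp' mP mc)) => m1 fr1 mB1.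
have inp1 := inputs_agree fr1 isT inp'; have mA1 := holds_mx_agree fr1 mA' isT.
apply: (wp_seq (wp_set_prod rn inp1 mA1 mB1)) => m2 fr2 mP2.
have inp2 := inputs_agree fr2 isT inp1.
apply: (@wp_frame N K set_coef); apply: wp_mono (wp_set_coef rn inp2 _ mP2) => [m3 mc3 fr3|].
  split=> //; first exact: (holds_mx_agree fr3 mP2 isT).
  by move=> _; apply: (holds_mx_agree fr3 (holds_mx_agree fr2 mB1 isT) isT).
by rewrite fr2 // fr1.
Qed.

Lemma wp_check_zero e (F : 'I_n -> int) b (ok : bool) m : m 0%N 0%N = n%:Z ->
  (forall (i : 'I_n) m', m' 6 0%N = i%:Z -> agree [:: 8; 6; 8] m m' -> meval m' e = F i) ->
  (forall i, `|F i| <= b)%N -> (n * b <= 2 ^ K)%N -> m 16 0%N = ok%:Z ->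
  wp (check_zero e) (fun m' => m' 16 0%N = (ok && (\sum_i F i == 0))%:Z) m.
Proof.
move=> m0 He Fb nb m16; apply: (wp_seq (wp_psum nN m0 He Fb nb)) => m1 fr m18.
have E : meval m1 (emul (cell 16) (eeq (cell 8) e0)) = (ok && (\sum_i F i == 0))%:Z.
  by rewrite /= m18 fr // m16; case: (ok); case: eqP.
apply: wp_mono (wp_set0 nN 16 E _) => [m2 -> //|].
by apply: (@leq_trans 1); [case: (_ && _)|rewrite expn_gt0].
Qed.

Local Notation b := (y - x).

Lemma diff_le l : (`|b l 0%R| <= 2 * W)%N.
Proof.
have -> : b l 0 = (y l 0 : int) - x l 0 by rewrite !mxE.
by have := xW l; have := yW l; lia.
Qed.

Lemma wp_check_sum (ok : bool) m : inputs m -> m 16 0%N = ok%:Z ->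
  wp check_sum (fun m' => m' 16 0%N = (ok && (\sum_v b v 0 == 0))%:Z) m.
Proof.
move=> inp m16; have [m0 _ _ _ _] := inp.
apply: (wp_check_zero m0 (b := (2 * W)%N) _ _ _ m16) => [l m' m'6 fr|l|].
- by have [_ _ _ m2 m3] := inputs_agree fr isT inp; rewrite /= m'6 m2 m3 !mxE.
- exact: diff_le.
- apply: (@leq_trans (W ^ 3)); last by apply: leWK; lia.
  by rewrite !expnS expn0 muln1 leq_mul // leq_mul2r W2 orbT.
Qed.

Lemma adj_term_le i l : (`|(adj_coef A 0 i l * b l 0)%R| <= W ^ (6 * n + 2))%N.
Proof.
have n0 : (0 < n)%N by apply: leq_ltn_trans (ltn_ord i).
have [_ [_ B]] := char_poly_coef_bound nW W2 lapJ_le (leq_pred n).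
have := B; rewrite prednK // subnn => /(_ (leqnn _) i l) {}B.
rewrite abszM; apply: (@leq_trans (W ^ (6 * n.-1).+1 * W ^ 2)).
  by apply: leq_mul => //; apply: leq_trans (diff_le l) _; rewrite leq_mul2r W2 orbT.
by rewrite -expnD leq_pexp2l //; lia.
Qed.

Lemma pot_le i : (`|pot i 0%R| <= W ^ (6 * n + 3))%N.
Proof.
rewrite mxE (_ : 6 * n + 3 = (6 * n + 2).+1)%N; last by lia.
by apply: leq_trans (nWle _); apply: absz_sum_le => l; apply: adj_term_le.
Qed.

Lemma wp_set_potential m : inputs m -> holds_mx m 10 (adj_coef A 0) ->
  wp set_potential (fun m' => holds_vec m' 13 (fun v => pot v 0)) m.
Proof.
move=> inp mB; have [m0 _ _ _ _] := inp.
apply: (wp_mapfor_vec nN) => // [i|i m' m'17 fr].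
  by apply: leq_trans (pot_le i) _; apply: leWK; lia.
have [m'0 _ _ _ _] := inputs_agree fr isT inp.
apply: wp_mono (wp_psum nN (F := fun l => adj_coef A 0 i l * b l 0) (b := W ^ (6 * n + 2)) m'0 _ _ _)
  => [m2 m28|l m2 m26 fr2|l|].
- by rewrite /= m28 mxE.
- have [m20 _ _ m22 m23] := inputs_agree fr2 isT (inputs_agree fr isT inp).
  have iE : meval m2 (cell 17) = i%:Z by rewrite /= fr2.
  have lE : meval m2 (cell 6) = l%:Z := m26.
  have := mx_getE m20 iE lE (holds_mx_agree fr2 (holds_mx_agree fr mB isT) isT).
  by move: (mx_get _ _ _) => ea /= ->; rewrite m26 m22 m23 !mxE.
- exact: adj_term_le.
- by apply: leq_trans (nWle _) _; apply: leWK; lia.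
Qed.

(** [p0] stands for cell 0 of array 13, the potential of vertex 0 if there is one; as a parameter it
    also makes sense for n = 0. *)
Definition firing (p0 : int) (v : 'I_n) : int := ((p0 - pot v 0)%R %/ lapJ_coef G)%Z.

Lemma pot0_le m (i : 'I_n) : holds_vec m 13 (fun v => pot v 0) ->
  (`|m 13 0%N| <= W ^ (6 * n + 3))%N.
Proof.
have n0 : (0 < n)%N by apply: leq_ltn_trans (ltn_ord i).
by move=> /(_ (Ordinal n0)) /= ->; apply: pot_le.
Qed.

Lemma firing_le m v : holds_vec m 13 (fun v => pot v 0) ->
  (`|firing (m 13 0%N) v| <= W ^ (6 * n + 4))%N.
Proof.
move=> mp; have := pot_le v; have := pot0_le v mp; rewrite /firing.
rewrite (_ : 6 * n + 4 = (6 * n + 3).+1)%N ?expnS; last by lia.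
move: (m 13 0%N) (pot v 0) (lapJ_coef G) (W ^ _)%N (lapJ_coef_neq0 dG eG) => p q c X c0 h1 h2.
apply: (@leq_trans (2 * X)); last by rewrite leq_mul2r W2 orbT.
have := divz_eq (p - q) c; have := modz_ge0 (p - q) c0; have := ltz_mod (p - q) c0.
move: ((p - q) %/ c)%Z ((p - q) %% c)%Z => k r r1 r0 e.
have : `|(k * c)%R|%N = (`|k| * `|c|)%N by rewrite abszM.
have : (0 < `|c|)%N by rewrite absz_gt0.
move: (k * c) e => kc e c1; case: `|k|%N => [//|k']; rewrite mulSn.
have : (k' <= k' * `|c|)%N by rewrite leq_pmulr.
lia.
Qed.

Lemma wp_set_firing m : inputs m -> holds_vec m 13 (fun v => pot v 0) ->
  m 12 0%N = lapJ_coef G -> wp set_firing (fun m' => holds_vec m' 14 (firing (m 13 0%N))) m.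
Proof.
move=> inp mp mc; have [m0 _ _ _ _] := inp.
apply: (wp_mapfor_vec nN) => // [i|i m' m'17 fr].
  by apply: leq_trans (firing_le i mp) _; apply: leWK; lia.
by rewrite /= m'17 (holds_vec_agree fr mp isT) !fr // mc.
Qed.

Lemma wp_check_dvd (ok : bool) (p0 : int) m : inputs m -> holds_vec m 13 (fun v => pot v 0) ->
  m 13 0%N = p0 -> m 12 0%N = lapJ_coef G -> holds_vec m 14 (firing p0) -> m 16 0%N = ok%:Z ->
  wp check_dvd (fun m' => m' 16 0%N =
    (ok && [forall v, firing p0 v * lapJ_coef G == p0 - pot v 0])%:Z) m.
Proof.
move=> inp mp m13 mc mF m16; have [m0 _ _ _ _] := inp.
pose F v := (firing p0 v * lapJ_coef G != p0 - pot v 0)%:Z.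
apply: wp_mono (wp_check_zero (F := F) m0 (b := 1) _ _ _ m16) => [m' ->|l m' m'6 fr|l|].
- congr (_ && _)%:Z; rewrite psumr_eq0 => [|v _]; last by rewrite /F; case: eqP.
  apply/allP/forallP => H v; last by move=> _; rewrite /F H.
  by have := H v (mem_index_enum v); rewrite /F /=; case: (_ * _ == _).
- rewrite /= m'6 (holds_vec_agree fr mF isT) (holds_vec_agree fr mp isT) !fr // mc m13 /F.
  by case: eqP.
- by rewrite /F; case: eqP.
- by rewrite muln1; apply: leq_trans NK.
Qed.

Definition holds_set m (S : {set 'I_n}) := holds_vec m 15 (fun v => (v \in S)%:Z).

Definition firing_support p0 : {set 'I_n} := [set v | [exists u, firing p0 u < firing p0 v]].

Lemma wp_set_support p0 m : inputs m -> holds_vec m 14 (firing p0) ->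
  wp set_support (fun m' => holds_set m' (firing_support p0)) m.
Proof.
move=> inp mF; have [m0 _ _ _ _] := inp.
apply: (wp_mapfor_vec nN) => // [i|i m' m'17 fr].
  by apply: (@leq_trans 1); [case: (_ \in _)|rewrite expn_gt0].
have [m'0 _ _ _ _] := inputs_agree fr isT inp.
pose F (u : 'I_n) := (firing p0 u < firing p0 i)%R%:Z.
apply: wp_mono (wp_psum nN (F := F) (b := 1%N) m'0 _ _ _) => [m2 m28|l m2 m26 fr2|l|].
- rewrite /= m28 inE.
  suff -> : (1 <= \sum_i F i) = [exists u, firing p0 u < firing p0 i].
    by case: [exists u, _].
  rewrite -gtz0_ge1 lt_def sumr_ge0 ?andbT // psumr_eq0 // -has_predC.
  apply/hasP/existsP => [[u _ /=]|[u hu]]; first by rewrite /F => Fu; exists u; move: Fu; case: (_ < _).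
  by exists u; rewrite ?mem_index_enum //= /F hu.
- have m217 : m2 17 0%N = i%:Z by rewrite fr2.
  rewrite /= m26 m217 !(holds_vec_agree fr2 (holds_vec_agree fr mF isT) isT) /F.
  by rewrite lezD1; case: ifP.
- by rewrite /F; case: (_ < _).
- by rewrite muln1; apply: leq_trans NK.
Qed.

Lemma wp_burn_step S (v : 'I_n) m : inputs m -> holds_set m S -> m 17 0%N = v%:Z ->
  wp burn_step (fun m' => holds_set m' (burn1 G y S v)) m.
Proof.
move=> inp mS m17; have [m0 _ _ _ _] := inp.
pose F u := (u \in S)%:Z * (G u v)%:Z.
have FW u : (`|F u| <= W)%N.
  by rewrite /F; case: (u \in S); rewrite ?mul1r ?mul0r ?absz0 //; apply: GW.
have nW2 : (n * W <= 2 ^ K)%N.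
  by apply: leq_trans (leWK (_ : 2 <= _)%N); [rewrite leq_mul2r nW orbT|lia].
have HF (l : 'I_n) m' : m' 6 0%N = l%:Z -> agree [:: 8; 6; 8] m m' ->
    meval m' (emul (Get 15 (cell 6)) (mx_get 1 (cell 6) (cell 17))) = F l.
  move=> m'6 fr; have [m'0 _ m'1 _ _] := inputs_agree fr isT inp.
  have lE : meval m' (cell 6) = l%:Z := m'6.
  have vE : meval m' (cell 17) = v%:Z by rewrite /= fr.
  have := mx_getE m'0 lE vE m'1; move: (mx_get _ _ _) => ea /= ->.
  by rewrite m'6 (holds_vec_agree fr mS isT).
apply: (wp_seq (wp_psum nN m0 HF FW nW2)) => m1 fr m18.
have [m10 _ _ _ m13] := inputs_agree fr isT inp.
have m117 : m1 17 0%N = v%:Z by rewrite fr.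
have sF : \sum_u F u = (inflow G S v)%:Z.
  rewrite /inflow sum_Posz [RHS]big_mkcond; apply: eq_bigr => u _.
  by rewrite /F; case: (u \in S); rewrite ?mul1r ?mul0r.
have E : meval m1 (emul (Get 15 (cell 17)) (ele (eadd (Get 3 (cell 17)) e1) (cell 8)))
    = (v \in burn1 G y S v)%:Z.
  rewrite /= m117 (holds_vec_agree fr mS isT) m13 m18 sF lezD1 /burn1 ltNge.
  case vS: (v \in S); rewrite ?mul0r ?mul1r /=; last by rewrite vS.
  by case: (_ <= y v 0); rewrite ?inE ?eqxx ?vS.
have vN : (v < N)%N by apply: leq_trans nleN.
have E' : meval m1 (cell 17) = v%:Z := m117.
apply: wp_mono (wp_set1 (k := v) 15 E' vN E _) => [m2 -> u|].
  rewrite /setm /= val_eqE; case: eqVneq => [->//|uv].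
  rewrite (holds_vec_agree fr mS isT) /burn1; case: ifP => // _.
  by rewrite !inE uv.
by apply: (@leq_trans 1); [case: (_ \in _)|rewrite expn_gt0].
Qed.

Lemma wp_burn S0 m : inputs m -> holds_set m S0 ->
  wp burn (fun m' => exists2 S, holds_set m' S & burnt G y S0 S n) m.
Proof.
move=> inp mS0; have [m0 _ _ _ _] := inp.
apply: (@wp_for N K 7 0 _ n (fun t m' => exists2 S, holds_set m' S & burnt G y S0 S t)) => //.
  by exists S0 => //; apply: burnt0.
move=> t m1 tn m17 fr [S1 mS1 bS1].
have inp1 := inputs_agree fr isT inp; have [m10 _ _ _ _] := inp1.
(* One round is the inner loop over all vertices; [burntS] closes it. *)
apply: (@wp_mono N K _ (fun m' => exists2 S, holds_set m' S & burn_inv G y S0 S1 S n)).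
  by move=> m' [S mS bS]; exists S => //; apply: burntS bS1 bS.
apply: (@wp_for N K 17 0 _ n (fun k m' => exists2 S, holds_set m' S & burn_inv G y S0 S1 S k)) => //.
  by exists S1 => //; apply: burnt_start bS1.
move=> k m2 kn m217 fr2 [S mS bS].
have inp2 := inputs_agree fr2 isT inp1.
apply: wp_mono (wp_burn_step inp2 mS (v := Ordinal kn) m217) => m3 mS3.
by exists (burn1 G y S (Ordinal kn)) => //; apply: (burn1_inv (v := Ordinal kn)).
Qed.

Lemma wp_check_burnt (S : {set 'I_n}) (ok : bool) m : inputs m -> holds_set m S ->
  m 16 0%N = ok%:Z -> wp check_burnt (fun m' => m' 16 0%N = (ok && (S == set0))%:Z) m.
Proof.
move=> inp mS m16; have [m0 _ _ _ _] := inp.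
apply: wp_mono (wp_check_zero (F := fun v => (v \in S)%:Z) m0 (b := 1) _ _ _ m16) => [m' ->|l m' m'6 fr|l|].
- congr (_ && _)%:Z; rewrite psumr_eq0 //; apply/allP/eqP => [H|-> v _]; last by rewrite inE.
  by apply/setP => v; have := H v (mem_index_enum v); rewrite inE; case: (v \in S).
- by rewrite /= m'6 (holds_vec_agree fr mS isT).
- by case: (_ \in _).
- by rewrite muln1; apply: leq_trans NK.
Qed.

Lemma wp_decide_reach m :
  m 0%N 0%N = n%:Z -> holds_mx m 1 (fun u v => (G u v)%:Z) ->
  holds_vec m 2 (fun v => x v 0) -> holds_vec m 3 (fun v => y v 0) ->
  (forall q, m 11 q = 0) ->
  wp decide_reach (fun m' => exists2 ok : bool, m' 0%N 0%N = ok%:Z & ok <-> reachable G x y) m.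
Proof.
move=> m0 m1 m2 m3 m11.
have K1 : (`|1%:Z| <= 2 ^ K)%N by rewrite expn_gt0.
have n2 : meval m (emul (cell 0) (cell 0)) = (n * n)%N%:Z by rewrite /= m0 PoszM.
apply: (wp_seq (wp_set0 nN 4 n2 (leq_trans (ltnW nN) NK))) => a1 _ a1E.
apply: (wp_seq (wp_set0 nN 12 (erefl : meval a1 e1 = 1) K1)) => a2 _ a2E.
apply: (wp_seq (wp_set0 nN 16 (erefl : meval a2 e1 = 1) K1)) => a3 _ a3E.
have inp : inputs a3 by rewrite a3E a2E a1E.
have z11 q : a3 11 q = 0 by rewrite a3E a2E a1E /setm /= m11.
have c12 : a3 12 0%N = 1 by rewrite a3E a2E.
have ok16 : a3 16 0%N = true%:Z by rewrite a3E.
move: a3 inp z11 c12 ok16 {a1 a1E a2 a2E a3E n2} => a inp z11 c12 ok16.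
apply: (wp_seq (wp_set_lapJ inp)) => b1 fr b1A.
have {}inp := inputs_agree fr isT inp.
have {}z11 q : b1 11 q = 0 by rewrite fr.
have {}c12 : b1 12 0%N = 1 by rewrite fr.
have {}ok16 : b1 16 0%N = true%:Z by rewrite fr.
move: {a m fr m0 m1 m2 m3 m11} b1 b1A inp z11 c12 ok16 => a aA inp z11 c12 ok16.
apply: (wp_seq (wp_faddeev_leverrier inp aA z11 c12)) => b1 fr [bB {}c12].
have {}inp := inputs_agree fr isT inp; have {}ok16 : b1 16 0%N = true%:Z by rewrite fr.
move: {a fr aA z11} b1 bB inp c12 ok16 => a aB inp c12 ok16.
apply: (wp_seq (wp_check_sum inp ok16)) => b1 fr {}ok16.
have {}inp := inputs_agree fr isT inp; have {}c12 : b1 12 0%N = lapJ_coef G by rewrite fr.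
have {}aB := holds_mx_agree fr aB isT.
move: {a fr} b1 aB inp c12 ok16 => a aB inp c12 ok16.
apply: (wp_seq (wp_set_potential inp aB)) => b1 fr bp.
have {}inp := inputs_agree fr isT inp; have {}c12 : b1 12 0%N = lapJ_coef G by rewrite fr.
rewrite -(fr 16%N) // in ok16.
move: {a fr aB} b1 bp inp c12 ok16 => a ap inp c12 ok16.
apply: (wp_seq (wp_set_firing inp ap c12)) => b1 fr bF.
have {}inp := inputs_agree fr isT inp; have {}c12 : b1 12 0%N = lapJ_coef G by rewrite fr.
have b13 : b1 13 0%N = a 13 0%N by rewrite fr.
have {}ap := holds_vec_agree fr ap isT; rewrite -(fr 16%N) // in ok16.
move: (a 13 0%N) b13 bF => p0 b13 bF {a fr}.
move: b1 ap inp c12 ok16 b13 bF => a ap inp c12 ok16 a13 aF.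
apply: (wp_seq (wp_check_dvd inp ap a13 c12 aF ok16)) => b1 fr {}ok16.
have {}inp := inputs_agree fr isT inp; have {}aF := holds_vec_agree fr aF isT.
have {}ap := holds_vec_agree fr ap isT; rewrite -(fr 13%N) // in a13.
move: {a fr c12} b1 inp aF ok16 ap a13 => a inp aF ok16 ap a13.
apply: (wp_seq (wp_set_support inp aF)) => b1 fr bS.
have {}inp := inputs_agree fr isT inp; rewrite -(fr 16%N) // in ok16.
rewrite -(fr 13%N) // in a13; have {}ap := holds_vec_agree fr ap isT.
move: {a fr aF} b1 inp bS ok16 ap a13 => a inp aS ok16 ap a13.
apply: (wp_seq (wp_burn inp aS)) => b1 fr [S bS burnS].
have {}inp := inputs_agree fr isT inp; rewrite -(fr 16%N) // in ok16.
rewrite -(fr 13%N) // in a13; have {}ap := holds_vec_agree fr ap isT.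
apply: (wp_seq (wp_check_burnt inp bS ok16)) => b2 fr2 ok2.
have := wp_set0 nN 0 (ok2 : meval b2 (cell 16) = _) (_ : (`|_| <= 2 ^ K)%N).
move=> H; apply: wp_mono (H _) => [m' ->|]; last first.
  by apply: (@leq_trans 1); [case: (_ && _)|rewrite expn_gt0].
(* Each vertex is compared with the reference [p0]; subtracting two such equations gives the
   hypothesis of [reachable_quot]. *)
have dvE : [forall v, firing p0 v * lapJ_coef G == p0 - pot v 0] -> forall u v,
    (firing p0 v - firing p0 u) * lapJ_coef G = pot u 0 - pot v 0.
  by move=> /forallP dv u v; rewrite mulrBl (eqP (dv u)) (eqP (dv v)); ring.
eexists; first by []; split.
  case/andP=> /andP [/eqP b0 /dvE dv] /eqP S0.
  by apply/(reachable_quot dG eG cx b0 dv)/(burnt_decide burnS).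
(* Reachability passes the first two tests: chips are conserved, and all divisions by [lapJ_coef]
   are exact. *)
move=> xy; have b0 := reachable_sum0 dG xy; rewrite /= b0 eqxx /=.
have dv : [forall v, firing p0 v * lapJ_coef G == p0 - pot v 0].
  apply/forallP => v; have n0 : (0 < n)%N by apply: leq_ltn_trans (ltn_ord v).
  by rewrite /firing divzK // -a13 (ap (Ordinal n0)) reachable_dvd.
by rewrite dv; apply/eqP/(burnt_decide burnS)/(reachable_quot dG eG cx b0 (dvE dv)).
Qed.

End Run.

(** * The encoded input and the final bounds *)

Lemma nth_allpairs_ord (T : Type) (n : nat) (f : 'I_n -> 'I_n -> T) x0 (i j : 'I_n) :
  nth x0 [seq f u v | u <- enum 'I_n, v <- enum 'I_n] (i * n + j) = f i j.
Proof.
have H (s : seq 'I_n) k (i0 : 'I_n) : (k < size s)%N ->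
    nth x0 [seq f u v | u <- s, v <- enum 'I_n] (k * n + j) = f (nth i0 s k) j.
  elim: s k => // u s IH k; rewrite allpairs_cons nth_cat size_map size_enum_ord.
  case: k => [_|k ks]; first by rewrite mul0n add0n ltn_ord (nth_map j) ?size_enum_ord // nth_ord_enum.
  by rewrite mulSn -addnA ltnNge leq_addr /= addKn IH.
by rewrite (H _ _ i) ?size_enum_ord // nth_ord_enum.
Qed.

Lemma leq_sum_mem (T : eqType) (s : seq T) (F : T -> nat) z :
  z \in s -> (F z <= \sum_(x <- s) F x)%N.
Proof. by move=> zs; rewrite (perm_big _ (perm_to_rem zs)) big_cons leq_addr. Qed.

Lemma nth_le_bit_size (s : store) a i : (`|nth 0%R (nth [::] s a) i| <= 2 ^ bit_size s)%N.
Proof.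
have [sa|sa] := leqP (size s) a; first by rewrite [nth [::] s a]nth_default // nth_nil; apply: leq0n.
have [si|si] := leqP (size (nth [::] s a)) i; first by rewrite nth_default //; apply: leq0n.
set z := nth 0 _ i; have zl : (`|z|.+1 <= 2 ^ up_log 2 `|z|.+1)%N by apply: up_logP.
apply: leq_trans (ltnW zl) _; rewrite leq_pexp2l //; apply: ltnW; apply: (@leq_trans (bitlen z)) => //.
apply: leq_trans (leq_sum_mem (fun l => \sum_(z <- l) bitlen z)%N (mem_nth [::] sa)).
exact: (leq_sum_mem bitlen (mem_nth 0 si)).
Qed.

Lemma num_ints_le_bit_size (s : store) : (num_ints s <= bit_size s)%N.
Proof.
apply: leq_sum => l _; rewrite -sum1_size; exact: leq_sum.
Qed.

Lemma size_map_enum_ord (T : Type) (n : nat) (f : 'I_n -> T) : size [seq f v | v <- enum 'I_n] = n.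
Proof. by rewrite size_map size_enum_ord. Qed.

Lemma num_ints_encode i : num_ints (encode i) = (1 + (nvert i * nvert i + (nvert i + nvert i)))%N.
Proof.
rewrite /num_ints /encode !big_cons big_nil size_allpairs !size_map_enum_ord !size_enum_ord /=; lia.
Qed.

Theorem theorem3p3 :
  exists p : cmd,
    strongly_polynomial_decider p encode
      (fun i : reach_instance => reachable (graph i) (source i) (target i)).
Proof.
exists (compile decide_reach).
have [c [k T]] := ptime_poly decide_reach.
(* The factor 2^k serves the time bound, as N + 1 is at most twice the number of input integers; 400
   * 400 and the exponent 3 serve the space bound, through N <= S and K <= 48 S^2. *)
exists (c * 2 ^ k + 400 * 400)%N, (k + 3)%N => i.
set s := encode i; set S := bit_size s; set n := nvert i.
(* [W] bounds [n] and all input numbers, and the 3 makes it at least 8; [N] exceeds all row-major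
   positions, and 2^K is W^(6n+6). *)
pose W := (2 ^ (S + 3))%N; pose N := (n * n).+1; pose K := ((S + 3) * (6 * n + 6))%N.
have ni : num_ints s = (1 + (n * n + (n + n)))%N by apply: num_ints_encode.
have niS : (num_ints s <= S)%N by apply: num_ints_le_bit_size.
have SW : (2 ^ S <= W)%N by rewrite leq_pexp2l // leq_addr.
have W8 : (8 <= W)%N by rewrite -[8%N]/(2 ^ 3)%N leq_pexp2l // leq_addl.
have nW : (n <= W)%N.
  by apply: leq_trans SW; apply: leq_trans (ltnW (ltn_expl S (ltnSn 1))); lia.
have WK : (W ^ (6 * n + 6) <= 2 ^ K)%N by rewrite /K expnM.
have NK : (N <= 2 ^ K)%N.
  apply: leq_trans WK; apply: (@leq_trans (W ^ 3)); last by rewrite leq_pexp2l //; lia.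
  by rewrite /N !expnS expn0 muln1; nia.
have WS a j : (`|nth 0%R (nth [::] s a) j| <= W)%N := leq_trans (nth_le_bit_size s a j) SW.
pose m : memory := fun a j => nth 0 (nth [::] s a) j.
have r : represents 18 N K s m.
  split=> [a j|//|a|a j]; first by [].
    case: a => [|[|[|[|a]]]]; rewrite /= ?size_allpairs ?size_map_enum_ord ?size_enum_ord -?/n /N ?nth_nil //.
    - by rewrite ltnW // ltnS; case: (n) => // k'; rewrite leq_pmulr.
    - by rewrite ltnW // ltnS; case: (n) => // k'; rewrite leq_pmulr.
  apply: leq_trans (WS a j) _; apply: leq_trans WK.
  by rewrite -{1}(expn1 W) leq_pexp2l //; lia.
have m1 : holds_mx m 1 (fun u v => (graph i u v)%:Z).
  by move=> u v; rewrite /m /= (nth_allpairs_ord (fun u v => (graph i u v)%:Z)).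
have m2 : holds_vec m 2 (fun v => source i v 0).
  by move=> v; rewrite /m /= (nth_map v) ?size_enum_ord // nth_ord_enum.
have m3 : holds_vec m 3 (fun v => target i v 0).
  by move=> v; rewrite /m /= (nth_map v) ?size_enum_ord // nth_ord_enum.
have m11 q : m 11 q = 0 by rewrite /m nth_default.
have GW u v : (graph i u v <= W)%N by have := WS 1%N (u * n + v)%N; rewrite [nth _ _ _]m1.
have xW v : (`|source i v 0%R| <= W)%N by have := WS 2 v; rewrite [nth _ _ _]m2.
have yW v : (`|target i v 0%R| <= W)%N by have := WS 3 v; rewrite [nth _ _ _]m3.
have H := wp_decide_reach (graph_digraph i) (@graph_eulerian i) (@source_chips i) W8 nW GW xW yW
  (ltnSn (n * n)) NK WK (erefl : m 0%N 0%N = n%:Z) m1 m2 m3 m11.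
have K0 : (0 < K)%N by rewrite /K muln_gt0 !addn_gt0 !orbT.
have [t [M [s' [m' [E tT MS [g _ _ _] [[ok m'0 okP] _]]]]]] :=
  exec_compile (nE := 40) (ltn0Sn _) K0 NK isT wf_decide_reach r H.
have ni0 : (0 < num_ints s)%N by rewrite ni.
have S0 : (0 < S)%N by apply: leq_trans niS.
exists t, M, s'; split=> //.
- apply: leq_trans tT (leq_trans (T N) _); apply: leq_trans (leq_addr _ _).
  apply: (@leq_trans (c * (2 * num_ints s) ^ k)).
    by rewrite leq_mul2l; case: (k) => [|k']; rewrite ?orbT // leq_exp2r //; lia.
  rewrite expnMn mulnA leq_mul ?leq_addr //.
  by rewrite leq_pexp2l // leq_addr.
- apply: leq_trans MS (leq_trans _ (leq_addr _ _)).
  apply: (@leq_trans (400 * 400 * S ^ 3)); last first.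
    by apply: leq_mul; [apply: leq_addl|rewrite leq_pexp2l // leq_addl].
  have NS : (N <= S)%N by rewrite /N; lia.
  have K48 : (K <= 48 * (S * S))%N by rewrite /K; nia.
  have h1 : (N * K.+2 <= 50 * (S * (S * S)))%N by rewrite mulnCA; apply: leq_mul => //; nia.
  have h2 : (S * S <= S * (S * S))%N by rewrite leq_pmull.
  have h3 : (0 < S * S)%N by rewrite muln_gt0 S0.
  have arith S3 S2 X k' : (X <= 50 * S3 -> S2 <= S3 -> 0 < S2 -> k' <= 48 * S2 ->
      18 * X + 2 * (40 * (40 * k').+2) <= 400 * 400 * S3)%N by clear; lia.
  by rewrite (_ : S ^ 3 = S * (S * S))%N ?(arith _ _ _ _ h1 h2 h3 K48) // !expnS expn0 muln1.
- by rewrite (g 0%N 0) m'0; case: ok okP {m'0} => okP; [left|right]; split=> //; [apply/okP|move/okP].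
Qed.
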